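(* Let $f:H\to H'$ be a morphism of discretely valued hyperfields which are not fields. Then $f$ is finite and flat if and only if the morphism of triples $\mathrm{Tr}(f)$ is finite and flat.
   Context: A hyperfield is a set $H$ with a multivalued addition $+:H\times H\to 2^H$ and a single-valued multiplication such that: $(x+y)+z=x+(y+z)$ for all $x,y,z$, where $(x+y)+z:=\bigcup_{t\in x+y}(t+z)$ and similarly on the right; $x+y=y+x$; there is $0\in H$ with $x+0=\{x\}$ for all $x$; for every $x$ there is a unique $-x$ with $0\in x+(-x)$; $x\in y-z$ iff $y\in x+z$ (where $y-z:=y+(-z)$); multiplication is commutative, associative, unital, with $(x+y)z\subseteq xz+yz$; $0\neq 1$ and every nonzero element is invertible. For subsets, $A+B=\bigcup_{a\in A,b\in B}(a+b)$; finite sums $\sum_s x_s$ are defined iteratively. A hyperfield ''is a field'' if all its sums are singletons. A valued hyperfield is a hyperfield with a map $|\cdot|:H\to\mathbb{R}$ such that (i) $|x|\ge0$ with equality iff $x=0$; (ii) $|xy|=|x||y|$; (iii) $|z|\le\max(|x|,|y|)$ for all $z\in x+y$; (iv) $|\cdot|$ is constant on $x+y$ unless $0\in x+y$ (this gives a metric $d(x,y)=|z|$ for any $z\in x-y$ when $x\neq y$, $d(x,x)=0$); (v) there is a real $\rho>0$ such that either $x+y$ is a closed ball of radius $\rho\max(|x|,|y|)$ for all $x,y$, or $x+y$ is an open ball of radius $\rho\max(|x|,|y|)$ for all $x,y$; the smallest such $\rho$ is denoted $\rho_H$. $H$ is discretely valued if $0$ is the only non-isolated point of $\{|x|:x\in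 H\}$. A morphism of valued hyperfields $f:H_1\to H_2$ is a map with $f(xy)=f(x)f(y)$, $f^{-1}(a+b)=f^{-1}(a)+f^{-1}(b)$ for all $a,b\in f(H_1)$, $|f(x)|=|x|$, and $f^{-1}(1)$ a ball. For $H$ discretely valued and not a field: $\theta_H$ is the smallest element of $\{|x|:x\neq0\}$ less than $1$; a uniformizer is $\pi$ with $|\pi|=\theta_H$; $\mathcal{O}_H$ is the closed ball of radius $1$ about $0$ and $\mathfrak{m}_H^k$ the closed ball of radius $\theta_H^k$ about $0$. A morphism $f:H\to H'$ is finite if there is a finite subset $S\subseteq\mathcal{O}_{H'}$ such that for every $x\in\mathcal{O}_{H'}$ there are elements $a_s\in\mathcal{O}_H$ ($s\in S$) with $x\in\sum_{s\in S}f(a_s)s$; it is flat if $\rho_H=\rho_{H'}$. Triples: a truncated DVR is a local Artinian ring $R$ whose maximal ideal $\mathfrak{m}_R$ is principal; $l(R)$ is its length as a module over itself. A triple $(R,M,\epsilon)$ is a truncated DVR $R$, a free $R$-module $M$ of rank $1$, and an $R$-linear $\epsilon:M\to R$ with image $\mathfrak{m}_R$. For integers $s\ge r$, $\epsilon_{r,s}:M^{\otimes s}\to M^{\otimes r}$ is the $R$-linear map with $x^{\otimes s}\mapsto\epsilon(x)^{s-r}x^{\otimes r}$ for a generator $x$. A morphism $(r,\phi,\eta):(R,M,\epsilon)\to(R',M',\epsilon')$ is a ring homomorphism $\phi:R\to R'$, an integer $r$, and an $R$-linear $\eta:M\to M'^{\otimes r}$ with $\phi\circ\epsilon=\epsilon'_{0,r}\circ\eta$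 and such that $M\otimes_RR'\to M'^{\otimes r}$ is an isomorphism. It is flat if $l(R')=r\,l(R)$ and finite if $\phi$ makes $R'$ a finitely generated $R$-module. Construction: for $H$ and $i\in\mathbb{Z}$, let $M_i=\mathfrak{m}_H^i/\!\sim$ where $x\sim y$ iff $d(x,y)\le\rho_H\theta_H^i$; the sum of classes of $\hat x,\hat y$ is the class of any element of $\hat x+\hat y$, and products of lifts give $M_i\times M_j\to M_{i+j}$. Put $R=M_0$, $M=M_1$; for a uniformizer $\pi$, $M_i$ is identified with $M^{\otimes i}$ by sending the class of $\pi^i$ to $\bar\pi^{\otimes i}$. $\epsilon:M\to R$ sends the class of $\hat x\in\mathfrak{m}_H$ to its class in $R$. $\mathrm{Tr}(H)=(R,M,\epsilon)$. For $f:H\to H'$, $\mathrm{Tr}(f)=(r,\phi,\eta)$ where $r=\log\theta_H/\log\theta_{H'}$, $\phi$ sends the class of $\hat x\in\mathcal{O}_H$ to the class of $f(\hat x)$, and $\eta:M\to M'^{\otimes r}\cong M'_r$ sends the class of $\hat x\in\mathfrak{m}_H$ to the class of $f(\hat x)\in\mathfrak{m}_{H'}^r$.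
   Formalization: θ_H is taken to be the largest, not the smallest, value |x| less than 1 (no smallest nonzero value exists, as the values accumulate at 0), and the open-ball case of axiom (v) is not required for x=y=0, where the ball would be empty. *)

(* Defs.v *)
From HB Require Import structures.
From mathcomp Require Import all_boot all_order all_algebra.
From mathcomp Require Import ring lra.
From mathcomp Require Import generic_quotient.
From mathcomp Require Import boolp classical_sets functions reals topology.
From mathcomp Require Import normedtype sequences exp.

Set Implicit Arguments.
Unset Strict Implicit.
Unset Printing Implicit Defensive.

Import Order.TTheory GRing.Theory Num.Theory.
Import numFieldNormedType.Exports.

Local Open Scope classical_set_scope.
Local Open Scope ring_scope.

Declare Scope hyper_scope.
Delimit Scope hyper_scope with hyper.
Local Open Scope hyper_scope.
Local Open Scope quotient_scope.

Reserved Notation "x [+] y" (at level 50, left associativity).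
Reserved Notation "x [-] y" (at level 50, left associativity).
Reserved Notation "x [*] y" (at level 40, left associativity).
Reserved Notation "[-] x" (at level 35, right associativity).

HB.mixin Record isHyperfield H of Choice H := {
  hzero : H;
  hone : H;
  hadd : H -> H -> set H;
  hopp : H -> H;
  hmul : H -> H -> H;
  haddA : forall x y z,
    \bigcup_(t in hadd x y) hadd t z = \bigcup_(t in hadd y z) hadd x t;
  haddC : forall x y, hadd x y = hadd y x;
  hadd0 : forall x, hadd x hzero = [set x];
  haddN : forall x y, hadd x y hzero <-> y = hopp x;
  hadd_rev : forall x y z, hadd y (hopp z) x <-> hadd x z y;
  hmulA : associative hmul;
  hmulC : commutative hmul;
  hmul1 : left_id hone hmul;
  hmulD : forall x y z t, hadd x y t -> hadd (hmul x z) (hmul y z) (hmul t z);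
  hone_neq0 : hzero <> hone;
  hmulV_ex : forall x, x <> hzero -> exists y, hmul x y = hone
}.

HB.structure Definition Hyperfield := {H of Choice H & isHyperfield H}.
Notation hyperfieldType := Hyperfield.type.

Arguments hzero {s}.
Arguments hone {s}.

Notation "x [+] y" := (hadd x y) : hyper_scope.
Notation "[-] x" := (hopp x) : hyper_scope.
Notation "x [-] y" := (hadd x (hopp y)) : hyper_scope.
Notation "x [*] y" := (hmul x y) : hyper_scope.

Definition hadds (H : hyperfieldType) (A B : set H) : set H :=
  \bigcup_(a in A) \bigcup_(b in B) (a [+] b).

Definition is_field (H : hyperfieldType) : Prop :=
  forall x y : H, exists z, x [+] y = [set z].

Definition hexp (H : hyperfieldType) (x : H) (n : nat) : H :=
  iter n (hmul x) hone.

(* The metric attached to a candidate absolute value v: v is constant on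
   x - y when x <> y, so any element of x - y may be used. *)
Definition hdist_of (K : realType) (H : hyperfieldType) (v : H -> K)
    (x y : H) : K :=
  if x == y then 0 else v (xget hzero (x [-] y)).

Definition hcball (K : realType) (H : hyperfieldType) (v : H -> K)
    (c : H) (r : K) : set H := [set y | hdist_of v c y <= r].

Definition hoball (K : realType) (H : hyperfieldType) (v : H -> K)
    (c : H) (r : K) : set H := [set y | hdist_of v c y < r].

(* An open ball of radius 0 is empty whereas 0 + 0 = {0}, so in the open case
   the pair x = y = 0 has to be left out. *)
Definition sum_radius (K : realType) (H : hyperfieldType) (v : H -> K)
    (rho : K) : Prop :=
  (forall x y, exists c, x [+] y = hcball v c (rho * Num.max (v x) (v y))) \/
  (forall x y, x <> hzero \/ y <> hzero ->
    exists c, x [+] y = hoball v c (rho * Num.max (v x) (v y))).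

HB.mixin Record isValuedHyperfield (K : realType) H of Hyperfield H := {
  hnorm : H -> K;
  hnorm_ge0 : forall x, 0 <= hnorm x;
  hnorm_eq0 : forall x, hnorm x = 0 <-> x = hzero;
  hnormM : forall x y, hnorm (x [*] y) = hnorm x * hnorm y;
  hnorm_ultra : forall x y z, (x [+] y) z ->
    hnorm z <= Num.max (hnorm x) (hnorm y);
  hnorm_cst : forall x y, ~ (x [+] y) hzero ->
    forall z t, (x [+] y) z -> (x [+] y) t -> hnorm z = hnorm t;
  hnorm_radius : exists2 rho, 0 < rho & sum_radius hnorm rho
}.

HB.structure Definition ValuedHyperfield (K : realType) :=
  {H of Hyperfield H & isValuedHyperfield K H}.
Notation valuedHyperfieldType := ValuedHyperfield.type.

(* 0 is the only non-isolated point of the set of absolute values.  Since the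
   radius rho in isValuedHyperfield is positive, this already implies that H
   is not a field (discValued_not_field). *)
HB.mixin Record isDiscretelyValued (K : realType) H
    of ValuedHyperfield K H := {
  hnorm_discrete :
    [set v | range (@hnorm K H) v /\ ~ isolated (range (@hnorm K H)) v]
    = [set 0]
}.

HB.structure Definition DiscValuedHyperfield (K : realType) :=
  {H of ValuedHyperfield K H & isDiscretelyValued K H}.
Notation discValuedHyperfieldType := DiscValuedHyperfield.type.

Definition hdist (K : realType) (H : valuedHyperfieldType K) : H -> H -> K :=
  hdist_of (@hnorm K H).

Definition is_ball (K : realType) (H : valuedHyperfieldType K) (A : set H) :=
  exists c r, 0 < r /\ (A = hcball hnorm c r \/ A = hoball hnorm c r).

(* An infimum, which is attained in the discretely valued case (rho_sum). *)
Definition rho (K : realType) (H : valuedHyperfieldType K) : K :=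
  inf [set r | 0 < r /\ sum_radius (@hnorm K H) r].

(* The value of a uniformizer, that is the largest |x| < 1; it is attained in
   the discretely valued case (theta_spec). *)
Definition theta (K : realType) (H : valuedHyperfieldType K) : K :=
  sup [set v | v < 1 /\ exists2 x : H, x <> hzero & v = hnorm x].

Definition uniformizer (K : realType) (H : valuedHyperfieldType K) (p : H) :=
  hnorm p = theta H.

(* O_H *)
Definition hint (K : realType) (H : valuedHyperfieldType K) : set H :=
  hcball hnorm hzero 1.

(* m_H^k *)
Definition hmpow (K : realType) (H : valuedHyperfieldType K) (k : nat) :
  set H := hcball hnorm hzero (theta H ^+ k).

Record vhMorphism (K : realType) (H H' : valuedHyperfieldType K) := VHMorphism {
  vhmap :> H -> H';
  vhmapM : forall x y, vhmap (x [*] y) = vhmap x [*] vhmap y;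
  vhmapD : forall a b, range vhmap a -> range vhmap b ->
    vhmap @^-1` (a [+] b) = hadds (vhmap @^-1` [set a]) (vhmap @^-1` [set b]);
  vhmap_norm : forall x, hnorm (vhmap x) = hnorm x;
  vhmap_ball : is_ball (vhmap @^-1` [set hone])
}.

Definition vh_finite (K : realType) (H H' : valuedHyperfieldType K)
    (f : vhMorphism H H') : Prop :=
  exists S : seq H', [/\ uniq S, (forall s, s \in S -> hint s) &
    forall x, hint x -> exists a : H' -> H,
      (forall s, s \in S -> hint (a s)) /\
      (\big[@hadds H'/[set hzero]]_(s <- S) [set f (a s) [*] s]) x].

Definition vh_flat (K : realType) (H H' : valuedHyperfieldType K)
    (f : vhMorphism H H') : Prop := rho H = rho H'.

Section HyperfieldTheory.
Variable H : hyperfieldType.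
Implicit Types x y z t u w : H.

Lemma haddA_l x y z t w : (x [+] y) t -> (t [+] z) w ->
  exists2 s, (y [+] z) s & (x [+] s) w.
Proof.
move=> xyt tzw.
have : (\bigcup_(t in hadd x y) hadd t z) w by exists t.
by rewrite haddA => -[s ys xsw]; exists s.
Qed.

Lemma haddA_r x y z s w : (y [+] z) s -> (x [+] s) w ->
  exists2 t, (x [+] y) t & (t [+] z) w.
Proof.
rewrite haddC => yzs; rewrite haddC => xsw.
have [t yxt ztw] := haddA_l yzs xsw.
by exists t; rewrite haddC.
Qed.

Lemma hadd0P x z : (x [+] hzero) z <-> z = x.
Proof. by rewrite hadd0. Qed.

Lemma h0addP x z : (hzero [+] x) z <-> z = x.
Proof. by rewrite haddC hadd0. Qed.

Lemma hsubxx x : (x [-] x) hzero.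
Proof. exact/haddN. Qed.

Lemma hsub0P x y : (x [-] y) hzero <-> x = y.
Proof.
split=> [|->]; last exact: hsubxx.
by move/hadd_rev; rewrite haddC hadd0.
Qed.

Lemma hoppK x : [-] ([-] x) = x.
Proof. by apply/esym/haddN; rewrite haddC; apply/haddN. Qed.

Lemma hadd_ex x y : exists z, (x [+] y) z.
Proof.
have e0 : (y [-] y) hzero := hsubxx y.
have xx : (x [+] hzero) x by apply/hadd0P.
by have [t xyt _] := haddA_r e0 xx; exists t.
Qed.

Lemma hsub_trans x y z w : (x [-] z) w ->
  exists a b, [/\ (x [-] y) a, (y [-] z) b & (a [+] b) w].
Proof.
move=> xzw.
have yy : ([-] y [+] y) hzero by rewrite haddC; exact: hsubxx.
have zz : (hzero [-] z) ([-] z) by apply/h0addP.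
have [b yzb nyb] := haddA_l yy zz.
have [a xya abw] := haddA_r nyb xzw.
by exists a, b.
Qed.

Lemma hmul1r x : x [*] hone = x. Proof. by rewrite hmulC hmul1. Qed.

Lemma hmulD_l x y z t : (x [+] y) t -> (z [*] x [+] z [*] y) (z [*] t).
Proof. by rewrite !(hmulC z); exact: hmulD. Qed.

Lemma hexpS x n : hexp x n.+1 = x [*] hexp x n. Proof. by []. Qed.

Lemma hexpD x m n : hexp x (m + n) = hexp x m [*] hexp x n.
Proof.
elim: m => [|m IHm]; first by rewrite add0n hmul1.
by rewrite addSn !hexpS IHm hmulA.
Qed.

(* Inverse of a nonzero element (hone for x = hzero). *)
Definition hinv x : H := xget hone [set y | x [*] y = hone].

Lemma hmulV x : x <> hzero -> x [*] hinv x = hone.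
Proof. by move/hmulV_ex => e; exact: (xgetPex hone e). Qed.

End HyperfieldTheory.

Section ValuedTheory.
Variables (K : realType) (H : valuedHyperfieldType K).
Implicit Types x y z t u w : H.

Lemma hnorm0 : hnorm (hzero : H) = 0. Proof. exact/hnorm_eq0. Qed.

Lemma hnorm_gt0 x : x <> hzero -> 0 < hnorm x.
Proof.
move=> x0; rewrite lt_neqAle hnorm_ge0 andbT eq_sym.
by apply/negP => /eqP/hnorm_eq0.
Qed.

Lemma hnorm_gt0N x : 0 < hnorm x -> x <> hzero.
Proof. by move=> + e; rewrite e hnorm0 ltxx. Qed.

Lemma hnorm1 : hnorm (hone : H) = 1.
Proof.
have n0 : hnorm (hone : H) != 0.
  apply/eqP => /hnorm_eq0 e; exact: (@hone_neq0 H).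
by apply: (mulfI n0); rewrite -hnormM hmul1 mulr1.
Qed.

Lemma hmul0 x : hzero [*] x = hzero.
Proof. by apply/hnorm_eq0; rewrite hnormM hnorm0 mul0r. Qed.

Lemma hmulr0 x : x [*] hzero = hzero.
Proof. by rewrite hmulC hmul0. Qed.

Lemma hmulN x y : ([-] x) [*] y = [-] (x [*] y).
Proof.
apply/haddN; rewrite -[hzero](hmul0 y); apply: hmulD.
exact: hsubxx.
Qed.

Lemma hnormN x : hnorm ([-] x) = hnorm x.
Proof.
have e1 : ([-] (hone : H)) [*] ([-] hone) = hone.
  by rewrite hmulN hmul1 hoppK.
have : hnorm ([-] (hone : H)) ^+ 2 = 1.
  by rewrite expr2 -hnormM e1 hnorm1.
move/eqP; rewrite sqrp_eq1 ?hnorm_ge0 // => /eqP n1.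
by rewrite -{1}[x]hmul1 -hmulN hnormM n1 mul1r.
Qed.

Lemma hopp0 : [-] (hzero : H) = hzero.
Proof. by apply/hnorm_eq0; rewrite hnormN hnorm0. Qed.

Lemma hoppD x y z : (x [+] y) z -> ([-] x [-] y) ([-] z).
Proof.
move/(@hmulD H _ _ ([-] hone)).
by rewrite ![_ [*] ([-] _)]hmulC !hmulN !hmul1.
Qed.

Lemma hsubC x y z : (x [-] y) z -> (y [-] x) ([-] z).
Proof. by move/hoppD; rewrite hoppK haddC. Qed.

Lemma hnormX x n : hnorm (hexp x n) = hnorm x ^+ n.
Proof.
elim: n => [|n IHn]; first by rewrite hnorm1.
by rewrite hexpS hnormM IHn exprS.
Qed.

Lemma hnormV x : x <> hzero -> hnorm (hinv x) = (hnorm x)^-1.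
Proof.
move=> x0; have := hnorm_gt0 x0 => xp.
by apply: (mulfI (lt0r_neq0 xp)); rewrite -hnormM hmulV // hnorm1 divff ?gt_eqF.
Qed.

Lemma hexp_neq0 x n : x <> hzero -> hexp x n <> hzero.
Proof.
move=> x0; apply: hnorm_gt0N; rewrite hnormX; apply: exprn_gt0.
exact: hnorm_gt0.
Qed.

Lemma hnorm_ultra_le x y z r : (x [+] y) z -> hnorm x <= r -> hnorm y <= r ->
  hnorm z <= r.
Proof. by move=> /hnorm_ultra h xr yr; apply: le_trans h _; rewrite ge_max xr. Qed.

Lemma hdistxx x : hdist x x = 0.
Proof. by rewrite /hdist /hdist_of eqxx. Qed.

Lemma hdistE x y z : x <> y -> (x [-] y) z -> hdist x y = hnorm z.
Proof.
move=> xy xyz; rewrite /hdist /hdist_of; case: eqP => // _.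
have n0 : ~ (x [-] y) hzero by move/hsub0P.
have hg : (x [-] y) (xget hzero (x [-] y)) by apply: xgetPex; exists z.
exact: (hnorm_cst _ _ n0 _ _ hg xyz).
Qed.

Lemma hdist_le x y z : (x [-] y) z -> hdist x y <= hnorm z.
Proof.
have [->|/eqP xy] := eqVneq x y; first by rewrite hdistxx hnorm_ge0.
by move=> h; rewrite (hdistE xy h).
Qed.

Lemma hdist_ge0 x y : 0 <= hdist x y.
Proof. by rewrite /hdist /hdist_of; case: eqP => // _; exact: hnorm_ge0. Qed.

Lemma hdistC x y : hdist x y = hdist y x.
Proof.
have [->//|/eqP xy] := eqVneq x y.
have [z xyz] := hadd_ex x ([-] y).
rewrite (hdistE xy xyz) (hdistE _ (hsubC xyz)) ?hnormN //.
by move=> e; apply: xy.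
Qed.

Lemma hdist0x x : hdist hzero x = hnorm x.
Proof.
have [->|/eqP x0] := eqVneq x hzero; first by rewrite hdistxx hnorm0.
rewrite (@hdistE _ _ ([-] x)) ?hnormN //; first by move=> e; exact: x0.
exact/h0addP.
Qed.

Lemma hdist_ultra x y z r : hdist x y <= r -> hdist y z <= r -> hdist x z <= r.
Proof.
have [->//|/eqP xy] := eqVneq x y.
have [<-//|/eqP yz] := eqVneq y z.
have [w xzw] := hadd_ex x ([-] z).
have [a [b [xya yzb abw]]] := hsub_trans y xzw.
rewrite (hdistE xy xya) (hdistE yz yzb) => ar br.
exact: le_trans (hdist_le xzw) (hnorm_ultra_le abw ar br).
Qed.

Lemma hdist_ultra_lt x y z r : hdist x y < r -> hdist y z < r -> hdist x z < r.
Proof.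
move=> xy yz.
apply: (@le_lt_trans _ _ (Num.max (hdist x y) (hdist y z))).
  by apply: (@hdist_ultra x y z); rewrite le_max lexx ?orbT.
by rewrite gt_max xy yz.
Qed.

Lemma hdistM x y z : hdist (z [*] x) (z [*] y) = hnorm z * hdist x y.
Proof.
have [->|/eqP xy] := eqVneq x y; first by rewrite !hdistxx mulr0.
have [->|/eqP z0] := eqVneq z hzero.
  by rewrite !hmul0 hdistxx hnorm0 mul0r.
have [w xyw] := hadd_ex x ([-] y).
rewrite (hdistE xy xyw) -hnormM; apply: hdistE.
  move=> e; apply: xy; rewrite -[x]hmul1 -[y]hmul1 -(hmulV z0).
  by rewrite ![z [*] hinv z]hmulC -!hmulA e.
by have := hmulD_l z xyw; rewrite [z [*] ([-] y)]hmulC hmulN [y [*] z]hmulC.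
Qed.

Lemma hintP x : hint x <-> hnorm x <= 1.
Proof. by rewrite /hint /hcball /= -/(hdist _ _) hdist0x. Qed.

Lemma hmpowP k x : hmpow k x <-> hnorm x <= theta H ^+ k.
Proof. by rewrite /hmpow /hcball /= -/(hdist _ _) hdist0x. Qed.

End ValuedTheory.

Section DiscreteTheory.
Variables (K : realType) (H : discValuedHyperfieldType K).
Implicit Types x y z t u w : H.

Let V : set K := range (@hnorm K H).

Lemma hnorm_isolated1 : isolated V 1.
Proof.
apply: contrapT => h1; have : [set v : K | V v /\ ~ isolated V v] 1.
  by split=> //; exists hone => //; exact: hnorm1.
by rewrite /V hnorm_discrete /= => /eqP; rewrite oner_eq0.
Qed.

Lemma hnorm_gap : exists2 d : K, 0 < d < 1 &
  forall x : H, hnorm x < 1 -> hnorm x <= d.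
Proof.
have [_ [U /nbhs_ballP[e /= e0 eU] VU]] := hnorm_isolated1.
pose m := Num.min e (2^-1).
have mgt0 : 0 < m by rewrite lt_min e0 invr_gt0 ltr0n.
have mlt1 : m < 1 by rewrite gt_min invf_lt1 ?ltr1n ?orbT.
exists (1 - m); first by apply/andP; split; lra.
move=> x x1; rewrite leNgt; apply/negP => mx.
have : (U `&` V) (hnorm x).
  split; last by exists x.
  apply: eU; rewrite /ball /=.
  rewrite ger0_norm ?subr_ge0 1?ltW //.
  have : m <= e by rewrite ge_min lexx.
  lra.
by rewrite VU => /= e1; rewrite e1 ltxx in x1.
Qed.

Lemma hnorm_small (e : K) : 0 < e -> exists2 x : H, x <> hzero & hnorm x < e.
Proof.
move=> e0; apply: contrapT => h.
have : [set v : K | V v /\ ~ isolated V v] 0 by rewrite /V hnorm_discrete.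
move=> [V0]; apply; split; first exact: mem_set.
exists (ball (0 : K) e); first exact: nbhsx_ballx.
apply/seteqP; split => [v|v /= ->]; last first.
  split => //; first exact: ballxx.
rewrite /ball /= => -[bv [x _ xv]]; move: bv; rewrite -xv sub0r normrN ger0_norm ?hnorm_ge0 // => xe.
apply/hnorm_eq0; apply: contrapT => x0; apply: h; by exists x.
Qed.

Lemma theta_spec : exists2 p : H, p <> hzero &
  [/\ theta H = hnorm p, 0 < theta H < 1 &
      forall x : H, hnorm x < 1 -> hnorm x <= theta H].
Proof.
pose A := [set v : K | v < 1 /\ exists2 x : H, x <> hzero & v = hnorm x].
have [d /andP[d0 d1] gap] := hnorm_gap.
have [q q0 q1] := hnorm_small ltr01.
have Aq : A (hnorm q) by split => //; exists q.
have ubA : ubound A 1 by move=> v [/ltW].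
have sA : has_sup A by split; [exists (hnorm q) | exists 1].
have s0 : 0 < sup A.
  apply: lt_le_trans (hnorm_gt0 q0) _; exact: sup_upper_bound.
have ds : 0 < sup A - d * sup A by rewrite subr_gt0 gtr_pMl.
have [v [v1 [p p0 vp]] pv] := sup_adherent ds sA.
rewrite opprB addrC subrK in pv.
have hv (w : K) : A w -> w <= v.
  move=> Aw; have [w1 [x x0 wx]] := Aw.
  rewrite leNgt; apply/negP => vw.
  have pp := hnorm_gt0 p0; have px := hnorm_gt0 x0.
  have : hnorm (p [*] hinv x) <= d.
    apply: gap; rewrite hnormM hnormV // ltr_pdivrMr // mul1r -wx -vp //.
  rewrite hnormM hnormV // ler_pdivrMr // -vp -wx => vdw.
  have : v <= d * sup A.
    apply: (le_trans vdw); rewrite ler_pM2l //; exact: sup_upper_bound.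
  by rewrite leNgt pv.
have sv : sup A = v.
  apply/eqP; rewrite eq_le sup_upper_bound ?andbT //; last by split => //; exists p.
  by apply: ge_sup; [exists (hnorm q)|].
exists p => //; rewrite /theta -/A sv vp; split => //.
  by rewrite hnorm_gt0 //= -vp.
move=> x x1; have [->|/eqP x0] := eqVneq x hzero; first by rewrite hnorm0 hnorm_ge0.
by rewrite -vp; apply: hv; split => //; exists x.
Qed.

Definition unif : H := xget hone [set p | uniformizer p].

Lemma unifP : uniformizer unif.
Proof.
apply: (xgetPex hone); have [p _ [e _ _]] := theta_spec.
by exists p.
Qed.

Lemma hnorm_unif : hnorm unif = theta H. Proof. exact: unifP. Qed.

Lemma theta_gt0 : 0 < theta H.
Proof. by have [p _ [_ /andP[]]] := theta_spec. Qed.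

Lemma theta_lt1 : theta H < 1.
Proof. by have [p _ [_ /andP[]]] := theta_spec. Qed.

Lemma theta_max x : hnorm x < 1 -> hnorm x <= theta H.
Proof. by have [p _ [_ _ h]] := theta_spec; exact: h. Qed.

Lemma thetaX_gt0 n : 0 < theta H ^+ n.
Proof. exact: exprn_gt0 theta_gt0. Qed.

Lemma thetaX_le m n : (m <= n)%N -> theta H ^+ n <= theta H ^+ m.
Proof.
by move=> mn; apply: ler_wiXn2l => //; rewrite ltW ?theta_gt0 ?theta_lt1.
Qed.

Lemma thetaX_leE m n : (theta H ^+ n <= theta H ^+ m) = (m <= n)%N.
Proof. by rewrite ler_iXn2l ?theta_gt0 ?theta_lt1. Qed.

Lemma thetaX_small (e : K) : 0 < e -> exists n, theta H ^+ n <= e.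
Proof.
move=> e0.
have : (fun n => theta H ^+ n) @ \oo --> (0 : K).
  by apply: cvg_expr; rewrite ger0_norm ?theta_lt1 // ltW ?theta_gt0.
move/cvgrPdist_lt => /(_ e e0) [N _ /(_ N (leqnn N))] /=.
by rewrite sub0r normrN ger0_norm ?(ltW (thetaX_gt0 _)) // => /ltW; exists N.
Qed.

Lemma unif_neq0 : unif <> hzero.
Proof. by apply: hnorm_gt0N; rewrite hnorm_unif theta_gt0. Qed.

Lemma hnorm_unifX n : hnorm (hexp unif n) = theta H ^+ n.
Proof. by rewrite hnormX hnorm_unif. Qed.

Lemma hnormP x : x <> hzero -> hnorm x <= 1 -> exists n, hnorm x = theta H ^+ n.
Proof.
move=> x0 x1; have xp := hnorm_gt0 x0.
have hex : exists n, theta H ^+ n < hnorm x.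
  have [n hn] := @thetaX_small (hnorm x / 2) (divr_gt0 xp (ltr0n _ 2)).
  by exists n; apply: (le_lt_trans hn); rewrite ltr_pdivrMr // ltr_pMr ?ltr1n.
case: (ex_minnP hex) => -[|n] hn hmin.
  by move: hn; rewrite expr0 ltNge x1.
exists n; apply/eqP; rewrite eq_le andbC; apply/andP; split.
  have xle : hnorm x <= theta H ^+ n.
    by rewrite leNgt; apply/negP => /hmin; rewrite ltnn.
  pose y := x [*] hinv (hexp unif n).
  have ye : hnorm y = hnorm x / theta H ^+ n.
    by rewrite hnormM hnormV ?hnorm_unifX //; apply: hexp_neq0; exact: unif_neq0.
  rewrite leNgt; apply/negP => xlt.
  have : hnorm y <= theta H.
    by apply: theta_max; rewrite ye ltr_pdivrMr ?thetaX_gt0 // mul1r.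
  by rewrite ye ler_pdivrMr ?thetaX_gt0 // -exprS leNgt hn.
by rewrite leNgt; apply/negP => /hmin; rewrite ltnn.
Qed.

Lemma hcball_sub r : 0 <= r -> (exists c, hone [-] (hone : H) = hcball hnorm c r) ->
  forall z, (hone [-] hone) z <-> hnorm z <= r.
Proof.
move=> r0 [c e] z.
have c0 : hdist c hzero <= r by have := hsubxx (hone : H); rewrite e.
rewrite e /hcball /= -/(hdist c z) -hdist0x; split => h.
  by apply: hdist_ultra h; rewrite hdistC.
exact: hdist_ultra h.
Qed.

Lemma hoball_sub r : (exists c, hone [-] (hone : H) = hoball hnorm c r) ->
  forall z, (hone [-] hone) z <-> hnorm z < r.
Proof.
move=> [c e] z.
have c0 : hdist c hzero < r by have := hsubxx (hone : H); rewrite e.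
rewrite e /hoball /= -/(hdist c z) -hdist0x; split => h.
  by apply: hdist_ultra_lt h; rewrite hdistC.
exact: hdist_ultra_lt h.
Qed.

Lemma sum_radius_one r : 0 < r -> sum_radius (@hnorm K H) r ->
  ((forall x y, exists c, x [+] y =
     hcball hnorm c (r * Num.max (hnorm x) (hnorm y))) /\
   forall z : H, (hone [-] hone) z <-> hnorm z <= r) \/
  ((forall x y, x <> hzero \/ y <> hzero -> exists c,
     x [+] y = hoball hnorm c (r * Num.max (hnorm x) (hnorm y))) /\
   forall z : H, (hone [-] hone) z <-> hnorm z < r).
Proof.
move=> r0 [h|h]; [left|right]; split => //.
  apply: hcball_sub; first exact: ltW.
  by have := h hone ([-] hone); rewrite hnormN hnorm1 maxxx mulr1.
apply: hoball_sub.
have h1 : (hone : H) <> hzero \/ ([-] hone : H) <> hzero.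
  by left => e; apply: (@hone_neq0 H).
by have := h hone ([-] hone) h1; rewrite hnormN hnorm1 maxxx mulr1.
Qed.

Lemma rho_spec : exists2 m, (0 < m)%N &
  [/\ rho H = theta H ^+ m,
      forall z : H, (hone [-] hone) z <-> hnorm z <= theta H ^+ m &
      forall x y : H, exists c,
        x [+] y = hcball hnorm c (theta H ^+ m * Num.max (hnorm x) (hnorm y))].
Proof.
have [r r0 hr] := @hnorm_radius K H.
have sr := sum_radius_one r0 hr.
have hex : exists n, `[< (hone [-] hone : set H) (hexp unif n) >].
  have [n hn] := @thetaX_small (r / 2) (divr_gt0 r0 (ltr0n _ 2)).
  exists n; apply/asboolP.
  have lt : theta H ^+ n < r.
    by apply: (le_lt_trans hn); rewrite ltr_pdivrMr // ltr_pMr ?ltr1n.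
  case: sr => -[_ ->]; rewrite hnorm_unifX //; exact: ltW.
case: (ex_minnP hex) => m /asboolP hm hmin.
have down z w : (hone [-] hone : set H) z -> hnorm w <= hnorm z -> (hone [-] hone) w.
  move=> hz wz; case: sr hz => -[_ e] /e zr; apply/e.
    exact: le_trans zr.
  exact: le_lt_trans zr.
have oneE z : (hone [-] hone) z <-> hnorm z <= theta H ^+ m.
  split => h; last by apply: down hm _; rewrite hnorm_unifX.
  have [->|/eqP z0] := eqVneq z hzero; first by rewrite hnorm0 ltW ?thetaX_gt0.
  have z1 : hnorm z <= 1.
    by apply: (hnorm_ultra_le h); rewrite ?hnormN hnorm1.
  have [n zn] := hnormP z0 z1.
  rewrite zn; apply: thetaX_le; apply: hmin; apply/asboolP.
  by apply: down h _; rewrite hnorm_unifX zn.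
have ballE s : 0 < s -> (forall z : H, hnorm z <= s <-> hnorm z <= theta H ^+ m) ->
  forall u : H, u <> hzero -> forall c z, hdist c z <= s * hnorm u <->
    hdist c z <= theta H ^+ m * hnorm u.
  move=> s0 hs u u0 c z; have up := hnorm_gt0 u0.
  have [->|/eqP cz] := eqVneq c z.
    rewrite hdistxx; split => _; apply: mulr_ge0; rewrite ?hnorm_ge0 //.
      exact: ltW (thetaX_gt0 _).
    exact: ltW.
  have [w czw] := hadd_ex c ([-] z).
  rewrite (hdistE cz czw) -!ler_pdivrMr // -hnormV // -hnormM; exact: hs.
have ballm (x y : H) : exists c,
    x [+] y = hcball hnorm c (theta H ^+ m * Num.max (hnorm x) (hnorm y)).
  have [[-> ->]|xy0] := pselect (x = hzero /\ y = hzero).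
    exists hzero; rewrite hadd0 hnorm0 maxxx mulr0; apply/seteqP.
    split => z /=; first by move=> ->; rewrite /hcball /= -/(hdist _ _) hdistxx.
    rewrite /hcball /= -/(hdist _ _) hdist0x => h.
    by apply/hnorm_eq0/eqP; rewrite eq_le h hnorm_ge0.
  have [u u0 ue] : exists2 u : H, u <> hzero & Num.max (hnorm x) (hnorm y) = hnorm u.
    have [xy|yx] := leP (hnorm x) (hnorm y).
      exists y => // y0; apply: xy0; split => //; apply/hnorm_eq0/eqP.
      by rewrite eq_le hnorm_ge0 andbT (le_trans xy) // y0 hnorm0.
    by exists x => // x0; move: yx; rewrite x0 hnorm0 ltNge hnorm_ge0.
  case: sr => -[hs h1].
    have [c e] := hs x y; exists c; rewrite e ue; apply/seteqP.
    have hh : forall z : H, hnorm z <= r <-> hnorm z <= theta H ^+ m.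
      by move=> z; split => [/h1/oneE|/oneE/h1].
    by split => z; have [] := ballE r r0 hh u u0 c z.
  have xy0' : x <> hzero \/ y <> hzero.
    apply: contrapT => /not_orP[/contrapT ? /contrapT ?]; exact: xy0.
  have [c e] := hs x y xy0'; exists c; rewrite e ue; apply/seteqP.
  have up := hnorm_gt0 u0.
  have lt_le z : hdist c z < r * hnorm u <-> hdist c z <= theta H ^+ m * hnorm u.
    have [->|/eqP cz] := eqVneq c z.
      rewrite hdistxx; split => _; last exact: mulr_gt0.
      by apply: mulr_ge0; rewrite ?hnorm_ge0 // ltW ?thetaX_gt0.
    have [w czw] := hadd_ex c ([-] z).
    rewrite (hdistE cz czw) -ler_pdivrMr // -ltr_pdivrMr // -hnormV // -hnormM.
    by split => [/h1/oneE|/oneE/h1].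
  by split => z /lt_le.
have radm : sum_radius (@hnorm K H) (theta H ^+ m) by left.
exists m; last first.
  split => //; rewrite /rho.
  set D := [set r : K | _].
  have Dm : D (theta H ^+ m) by split => //; exact: thetaX_gt0.
  have lbD : lbound D (theta H ^+ m).
    move=> s [s0 /(sum_radius_one s0)] [] [_ h].
      by have /h := hm; rewrite hnorm_unifX.
    by have /h := hm; rewrite hnorm_unifX => /ltW.
  apply/eqP; rewrite eq_le ge_inf //=; last by exists (theta H ^+ m).
  by apply: lb_le_inf => //; exists (theta H ^+ m).
rewrite lt0n; apply/eqP => m0; rewrite m0 expr0 in oneE radm ballm.
have hp : ~ (hone [-] unif) hzero.
  move/hsub0P => e; have := theta_lt1; by rewrite -hnorm_unif -e hnorm1 ltxx.
have r1 : ~ (hone [-] unif : set H) hzero -> False.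
  have mx : Num.max (hnorm (hone : H)) (hnorm ([-] unif)) = 1.
    rewrite hnormN hnorm1 hnorm_unif max_l // ltW //; exact: theta_lt1.
  have [w hw] := hadd_ex (hone : H) ([-] unif).
  have w1 : hnorm w <= 1.
    by have := hnorm_ultra _ _ _ hw; rewrite mx.
  move=> nz; case: (sum_radius_one ltr01 radm) => -[hs h1].
    apply: nz; have [c e] := hs hone ([-] unif).
    move: hw; rewrite e mx mulr1 /hcball /= -!/(hdist _ _) => cw.
    by apply: hdist_ultra cw _; rewrite hdistC hdist0x.
  have /oneE/h1 : hnorm (hone : H) <= 1 by rewrite hnorm1.
  by rewrite hnorm1 ltxx.
exact: r1 hp.
Qed.

Lemma rho_ex : exists2 m, (0 < m)%N &
  rho H = theta H ^+ m /\
  forall z : H, (hone [-] hone) z <-> hnorm z <= theta H ^+ m.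
Proof. by have [m m0 [e h _]] := rho_spec; exists m. Qed.

Lemma rho_sum x y : exists c,
  x [+] y = hcball hnorm c (rho H * Num.max (hnorm x) (hnorm y)).
Proof. by have [m _ [-> _ h]] := rho_spec; exact: h. Qed.

Lemma rho_sub1 z : (hone [-] hone : set H) z <-> hnorm z <= rho H.
Proof. by have [m _ [-> ]] := rho_ex. Qed.

Lemma rho_gt0 : 0 < rho H.
Proof. by have [m _ [-> _]] := rho_ex; exact: thetaX_gt0. Qed.

Lemma rho_lt1 : rho H < 1.
Proof.
have [m m0 [-> _]] := rho_ex; rewrite exprn_ilt1 ?theta_lt1 -?lt0n //.
exact/ltW/theta_gt0.
Qed.

Lemma rho_sub x z : (x [-] x) z -> hnorm z <= rho H * hnorm x.
Proof.
have [->|/eqP x0] := eqVneq x hzero.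
  by rewrite hopp0 => /hadd0P ->; rewrite hnorm0 mulr0.
move/(@hmulD_l H _ _ (hinv x)).
rewrite [hinv x [*] ([-] x)]hmulC hmulN ![_ [*] x]hmulC hmulV //.
move/rho_sub1.
by rewrite hnormM hnormV // mulrC ler_pdivrMr ?hnorm_gt0.
Qed.

Lemma hdist_rho k x y z : hmpow k x -> (x [-] y) z ->
  hdist x y <= rho H * theta H ^+ k <-> hnorm z <= rho H * theta H ^+ k.
Proof.
move=> /hmpowP xk xyz; split => [|h]; last exact: le_trans (hdist_le xyz) h.
have [exy _|/eqP xy] := eqVneq x y; last by rewrite (hdistE xy xyz).
move: xyz; rewrite -exy => /rho_sub h; apply: (le_trans h).
by rewrite ler_pM2l ?rho_gt0.
Qed.

Lemma discValued_not_field : ~ is_field H.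
Proof.
move=> /(_ hone ([-] hone)) [z e]; have [m _ [_ h]] := rho_ex.
have : (hone [-] hone : set H) hzero by exact: hsubxx.
rewrite e /= => ez.
have : (hone [-] hone : set H) (hexp unif m) by apply/h; rewrite hnorm_unifX.
by rewrite e /= -ez; apply: hexp_neq0; exact: unif_neq0.
Qed.

End DiscreteTheory.

Section Length.
Variables (R : comNzRingType) (M : lmodType R).

Definition is_submod (N : set M) : Prop :=
  N 0 /\ forall (a : R) x y, N x -> N y -> N (a *: x + y).

Definition submod_chain (n : nat) : Prop :=
  exists N : nat -> set M, [/\ forall i, is_submod (N i),
    forall i, (i < n)%N -> N i `<=` N i.+1 &
    forall i, (i < n)%N -> N i <> N i.+1].

(* The length: the largest n such that there is a strict chain
   N_0 < N_1 < ... < N_n of submodules (and 0 if there is no largest one). *)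
Definition mod_length : nat :=
  xget 0%N [set n | submod_chain n /\ forall k, submod_chain k -> (k <= n)%N].

Definition artinian : Prop :=
  forall N : nat -> set M, (forall i, is_submod (N i)) ->
    (forall i, N i.+1 `<=` N i) -> exists n, forall i, (n <= i)%N -> N i = N n.

Definition free_rank1 : Prop :=
  exists x : M, forall m, exists! a : R, m = a *: x.

Definition fin_gen : Prop :=
  exists s : seq M, forall m, exists c : nat -> R,
    m = \sum_(i < size s) c i *: s`_i.

End Length.

Definition maximal_ideal (R : comNzRingType) (I : set R) : Prop :=
  [/\ is_submod (I : set R^o), I <> setT &
    forall J : set R, is_submod (J : set R^o) -> I `<=` J -> J = I \/ J = setT].

Definition truncated_dvr (R : comNzRingType) : Prop :=
  artinian R^o /\ exists m : set R,
    [/\ maximal_ideal m, forall J, maximal_ideal J -> J = m &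
        exists t, m = range (fun a => a * t)].

(* Formal sums of pure tensors x (x) y, i.e. sequences of pairs, modulo the
   least congruence making the pure tensors bilinear. *)
Inductive tensor_eq (R : comNzRingType) (M N : lmodType R) :
    seq (M * N) -> seq (M * N) -> Prop :=
| teq_refl s : tensor_eq s s
| teq_sym s t : tensor_eq s t -> tensor_eq t s
| teq_trans s t u : tensor_eq s t -> tensor_eq t u -> tensor_eq s u
| teq_cat s s' t t' : tensor_eq s s' -> tensor_eq t t' ->
    tensor_eq (s ++ t) (s' ++ t')
| teq_catC s t : tensor_eq (s ++ t) (t ++ s)
| teq_0 y : tensor_eq [:: (0, y)] [::]
| teq_Dl x x' y : tensor_eq [:: (x + x', y)] [:: (x, y); (x', y)]
| teq_Dr x y y' : tensor_eq [:: (x, y + y')] [:: (x, y); (x, y')]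
| teq_Z a x y : tensor_eq [:: (a *: x, y)] [:: (x, a *: y)].

Section Tensor.
Variables (R : comNzRingType) (M N : lmodType R).
Implicit Types (s t u : seq (M * N)) (x : M) (y : N).

Definition tensor_eqb s t : bool := `[< tensor_eq s t >].

Lemma tensor_eqb_refl : reflexive tensor_eqb.
Proof. by move=> s; apply/asboolP; exact: teq_refl. Qed.

Lemma tensor_eqb_sym : symmetric tensor_eqb.
Proof. by move=> s t; apply/asboolP/asboolP => h; exact: teq_sym. Qed.

Lemma tensor_eqb_trans : transitive tensor_eqb.
Proof.
by move=> t s u /asboolP h /asboolP h'; apply/asboolP; exact: teq_trans h h'.
Qed.

Canonical tensor_equiv :=
  EquivRel tensor_eqb tensor_eqb_refl tensor_eqb_sym tensor_eqb_trans.

Definition tensor := {eq_quot tensor_equiv}.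

HB.instance Definition _ := Choice.on tensor.
HB.instance Definition _ := EqQuotient.on tensor.

Definition tcls s : tensor := \pi_tensor s.

Lemma tclsP s t : tcls s = tcls t <-> tensor_eq s t.
Proof.
split=> [/eqmodP /asboolP //|h].
by apply/eqmodP/asboolP.
Qed.

Lemma tclsK (z : tensor) : tcls (repr z) = z.
Proof. by rewrite /tcls reprK. Qed.

Lemma repr_tcls s : tensor_eq (repr (tcls s)) s.
Proof. by apply/tclsP; rewrite tclsK. Qed.

Definition tscale_seq (a : R) s := [seq (a *: p.1, p.2) | p <- s].

Lemma tscale_seq_eq a s t : tensor_eq s t ->
  tensor_eq (tscale_seq a s) (tscale_seq a t).
Proof.
rewrite /tscale_seq; elim=> {s t} [s|s t _|s t u _ h1 _ h2|s s' t t' _ h1 _ h2|s t|y|x x' y|x y y'|b x y] //=.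
- exact: teq_refl.
- exact: teq_sym.
- exact: teq_trans h1 h2.
- by rewrite !map_cat; exact: teq_cat.
- by rewrite !map_cat; exact: teq_catC.
- by rewrite scaler0; exact: teq_0.
- by rewrite scalerDr; exact: teq_Dl.
- exact: teq_Dr.
- by rewrite scalerA mulrC -scalerA; exact: teq_Z.
Qed.

Definition tadd (z w : tensor) : tensor := tcls (repr z ++ repr w).
Definition tscale (a : R) (z : tensor) : tensor := tcls (tscale_seq a (repr z)).
Definition topp (z : tensor) : tensor := tscale (-1) z.

Lemma tadd_cls s t : tadd (tcls s) (tcls t) = tcls (s ++ t).
Proof. by apply/tclsP; apply: teq_cat; exact: repr_tcls. Qed.

Lemma tscale_cls a s : tscale a (tcls s) = tcls (tscale_seq a s).
Proof. by apply/tclsP; apply: tscale_seq_eq; exact: repr_tcls. Qed.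

Lemma taddA : associative tadd.
Proof.
move=> z w v; rewrite -[z]tclsK -[w]tclsK -[v]tclsK.
by rewrite !tadd_cls catA.
Qed.

Lemma taddC : commutative tadd.
Proof. by move=> z w; apply/tclsP; exact: teq_catC. Qed.

Lemma tadd0 : left_id (tcls [::]) tadd.
Proof. by move=> z; rewrite -[z]tclsK tadd_cls. Qed.

Lemma tscale1 : left_id 1 tscale.
Proof.
move=> z; rewrite -[RHS]tclsK /tscale /tscale_seq.
by congr tcls; rewrite -[RHS]map_id; apply: eq_map => -[x y] /=; rewrite scale1r.
Qed.

Lemma tscaleDl z : {morph tscale^~ z : a b / a + b >-> tadd a b}.
Proof.
move=> a b; rewrite -[z]tclsK !tscale_cls tadd_cls; apply/tclsP.
elim: (repr z) => [|[x y] s IHs] /=; first exact: teq_refl.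
rewrite /= -[_ :: tscale_seq _ _]cat1s.
apply: (@teq_trans _ _ _ _ ([:: (a *: x, y); (b *: x, y)] ++
    (tscale_seq a s ++ tscale_seq b s))).
  by apply: teq_cat => //; rewrite scalerDl; exact: teq_Dl.
rewrite -[_ :: _ ++ _]cat1s -[_ :: tscale_seq b s]cat1s /=.
rewrite -[_ :: (b *: x, y) :: _]cat1s -[(a *: x, y) :: _ ++ _]cat1s.
apply: teq_cat; first exact: teq_refl.
rewrite -[_ :: _ ++ _]cat1s !catA -[_ :: tscale_seq b s]cat1s catA.
by apply: teq_cat; [exact: teq_catC | exact: teq_refl].
Qed.

Lemma tscaleDr a : {morph tscale a : z w / tadd z w}.
Proof.
move=> z w; rewrite -[z]tclsK -[w]tclsK tadd_cls !tscale_cls tadd_cls.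
by rewrite /tscale_seq map_cat.
Qed.

Lemma tscaleA a b z : tscale a (tscale b z) = tscale (a * b) z.
Proof.
rewrite -[z]tclsK !tscale_cls /tscale_seq -map_comp; congr tcls.
by apply: eq_map => -[x y] /=; rewrite scalerA.
Qed.

Lemma tscale0 z : tscale 0 z = tcls [::].
Proof.
rewrite -[z]tclsK tscale_cls; apply/tclsP.
elim: (repr z) => [|[x y] s IHs] /=; first exact: teq_refl.
rewrite -cat1s -[X in tensor_eq _ X](cat0s [::]); apply: teq_cat => //.
by rewrite scale0r; exact: teq_0.
Qed.

Lemma taddN : left_inverse (tcls [::]) topp tadd.
Proof.
by move=> z; rewrite /topp -{2}[z]tscale1 -tscaleDl addNr tscale0.
Qed.

HB.instance Definition _ :=
  GRing.isZmodule.Build tensor taddA taddC tadd0 taddN.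
HB.instance Definition _ :=
  GRing.Zmodule_isLmodule.Build R tensor tscaleA tscale1 tscaleDr tscaleDl.

Lemma tclsD s t : tcls s + tcls t = tcls (s ++ t).
Proof. exact: tadd_cls. Qed.

Definition tpure x y : tensor := tcls [:: (x, y)].

(* The additive map x (x) y |-> g x y attached to g; it is meant for g that
   respect tensor_eq. *)
Definition tlift (P : zmodType) (g : M -> N -> P) (z : tensor) : P :=
  \sum_(p <- repr z) g p.1 p.2.

Definition balanced (P : zmodType) (g : M -> N -> P) : Prop :=
  [/\ forall x x' y, g (x + x') y = g x y + g x' y,
      forall x y y', g x (y + y') = g x y + g x y' &
      forall a x y, g (a *: x) y = g x (a *: y)].

Lemma tlift_cls (P : zmodType) (g : M -> N -> P) s : balanced g ->
  tlift g (tcls s) = \sum_(p <- s) g p.1 p.2.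
Proof.
move=> [gDl gDr gZ].
suff h s0 s1 : tensor_eq s0 s1 ->
    \sum_(p <- s0) g p.1 p.2 = \sum_(p <- s1) g p.1 p.2.
  exact: h (repr_tcls s).
elim=> {s s0 s1} [//|s t _ ->//|s t u _ -> _ -> //|s s' t t' _ h1 _ h2|s t|y|x x' y|x y y'|b x y].
- by rewrite !big_cat /= h1 h2.
- by rewrite !big_cat /= addrC.
- rewrite big_seq1 big_nil /=.
  by apply: (addrI (g 0 y)); rewrite -gDl !addr0.
- by rewrite big_seq1 !big_cons big_nil addr0 gDl.
- by rewrite big_seq1 !big_cons big_nil addr0 gDr.
- by rewrite !big_seq1 gZ.
Qed.

Lemma tlift_pure (P : zmodType) (g : M -> N -> P) x y : balanced g ->
  tlift g (tpure x y) = g x y.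
Proof. by move=> gb; rewrite tlift_cls // big_seq1. Qed.

Lemma tliftD (P : zmodType) (g : M -> N -> P) : balanced g ->
  {morph tlift g : z w / z + w}.
Proof.
move=> gb z w; rewrite -[z]tclsK -[w]tclsK tclsD !tlift_cls //.
by rewrite big_cat.
Qed.

Lemma tlift0 (P : zmodType) (g : M -> N -> P) : balanced g -> tlift g 0 = 0.
Proof. by move=> gb; rewrite tlift_cls // big_nil. Qed.

Lemma tscale_pure a x y : a *: tpure x y = tpure (a *: x) y.
Proof. exact: tscale_cls. Qed.

Lemma tpureDl x x' y : tpure (x + x') y = tpure x y + tpure x' y.
Proof. by rewrite [RHS]tclsD; apply/tclsP; exact: teq_Dl. Qed.

Lemma tpureDr x y y' : tpure x (y + y') = tpure x y + tpure x y'.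
Proof. by rewrite [RHS]tclsD; apply/tclsP; exact: teq_Dr. Qed.

Lemma tpureZ a x y : tpure (a *: x) y = tpure x (a *: y).
Proof. by apply/tclsP; exact: teq_Z. Qed.

Lemma tensor_gen x (hx : forall m, exists a : R, m = a *: x) (z : tensor) :
  exists y, z = tpure x y.
Proof.
rewrite -[z]tclsK; elim: (repr z) => [|[m y] s [y' IHs]].
  exists 0; apply/tclsP; apply: teq_sym.
  have := teq_Z 0 x (0 : N); rewrite scale0r scaler0 => /teq_sym h.
  by apply: teq_trans h _; exact: teq_0.
have [a ->] := hx m; exists (a *: y + y').
rewrite tpureDr -tpureZ -IHs [RHS]tclsD //.
Qed.

End Tensor.

(* An R'-module seen as an R-module through phi. *)
Definition restr (R R' : comNzRingType) (phi : {rmorphism R -> R'})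
  (N : lmodType R') : Type := N.

Section Restr.
Variables (R R' : comNzRingType) (phi : {rmorphism R -> R'}) (N : lmodType R').

HB.instance Definition _ := GRing.Zmodule.on (restr phi N).

Definition restr_scale (a : R) (y : restr phi N) : restr phi N :=
  phi a *: (y : N).

Lemma restr_scaleA a b y :
  restr_scale a (restr_scale b y) = restr_scale (a * b) y.
Proof. by rewrite /restr_scale scalerA rmorphM. Qed.

Lemma restr_scale1 : left_id 1 restr_scale.
Proof. by move=> y; rewrite /restr_scale rmorph1 scale1r. Qed.

Lemma restr_scaleDr : right_distributive restr_scale +%R.
Proof. by move=> a y y'; rewrite /restr_scale scalerDr. Qed.

Lemma restr_scaleDl y : {morph restr_scale^~ y : a b / a + b}.
Proof. by move=> a b; rewrite /restr_scale rmorphD scalerDl. Qed.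

HB.instance Definition _ := GRing.Zmodule_isLmodule.Build R (restr phi N)
  restr_scaleA restr_scale1 restr_scaleDr restr_scaleDl.
End Restr.

(* Tensor powers, for nonnegative exponents. *)
Fixpoint tpow (R : comNzRingType) (M : lmodType R) (r : nat) : lmodType R :=
  if r is r'.+1 then tensor M (tpow M r') : lmodType R else R^o.

(* x (x) ... (x) x *)
Fixpoint tpower (R : comNzRingType) (M : lmodType R) (x : M) (r : nat) :
    tpow M r :=
  if r is r'.+1 then tpure x (tpower x r') else (1 : R).

(* eps_{0,r} : M^{(x) r} -> R, with x1 (x) ... (x) xr |-> eps x1 * ... * eps xr *)
Fixpoint eps_pow (R : comNzRingType) (M : lmodType R) (eps : M -> R) (r : nat) :
    tpow M r -> R :=
  if r is r'.+1 return tpow M r -> R then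
    tlift (fun x z => eps x * @eps_pow R M eps r' z)
  else (fun a => a).

(* tr_ring is local, so tr_image says that the image of eps is its maximal
   ideal. *)
Record triple := Triple {
  tr_ring : comNzRingType;
  tr_mod : lmodType tr_ring;
  tr_eps : {linear tr_mod -> tr_ring^o};
  tr_tdvr : truncated_dvr tr_ring;
  tr_free : free_rank1 tr_mod;
  tr_image : maximal_ideal (range tr_eps)
}.

(* The degree is a natural number: the compatibility condition involves
   eps'_{0,r}, which is only defined for r >= 0. *)
Record tripleMorphism (T T' : triple) := TripleMorphism {
  tm_deg : nat;
  tm_phi : {rmorphism tr_ring T -> tr_ring T'};
  tm_eta : {linear tr_mod T -> restr tm_phi (tpow (tr_mod T') tm_deg)};
  tm_compat : forall x : tr_mod T,
    tm_phi (tr_eps T x) = eps_pow (tr_eps T') (tm_eta x);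
  tm_iso : bijective
    (tlift (fun (x : tr_mod T) (a : restr tm_phi (tr_ring T')^o) =>
       (a : tr_ring T') *: (tm_eta x : tpow (tr_mod T') tm_deg)))
}.

Definition tm_flat (T T' : triple) (F : tripleMorphism T T') : Prop :=
  mod_length (tr_ring T')^o = (tm_deg F * mod_length (tr_ring T)^o)%N.

Definition tm_finite (T T' : triple) (F : tripleMorphism T T') : Prop :=
  fin_gen (restr (tm_phi F) (tr_ring T')^o).

Section TensorPower.
Variables (R : comNzRingType) (M : lmodType R).

Lemma tpower_gen (x : M) (hx : forall m, exists a : R, m = a *: x) r
  (z : tpow M r) : exists a : R, z = a *: tpower x r.
Proof.
elim: r z => [|r IHr] z /=; first by exists z; rewrite /GRing.scale /= mulr1.
have [y ->] := tensor_gen hx z; have [a ->] := IHr y.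
by exists a; rewrite tscale_pure tpureZ.
Qed.

(* Coordinate on the tensor power induced by a coordinate on M. *)
Lemma eps_pow_balanced (l : {linear M -> R^o}) r :
  balanced (fun (x : M) z => l x * @eps_pow R M l r z) /\
  (forall a z, @eps_pow R M l r (a *: z) = a * eps_pow l z) /\
  {morph @eps_pow R M l r : z w / z + w}.
Proof.
have bal r' : (forall a z, @eps_pow R M l r' (a *: z) = a * eps_pow l z) ->
  {morph @eps_pow R M l r' : z w / z + w} ->
  balanced (fun (x : M) z => l x * @eps_pow R M l r' z).
  move=> hZ hD; split=> [x x' y|x y y'|a x y].
  - by rewrite linearD mulrDl.
  - by rewrite hD mulrDr.
  - by rewrite linearZ hZ /= /GRing.scale /= mulrCA mulrA.
elim: r => [|r [b [hZ hD]]]; first by split => //; apply: (bal 0%N).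
have hZ' a z : @eps_pow R M l r.+1 (a *: z) = a * eps_pow l z.
  rewrite -[z]tclsK /= [a *: _]tscale_cls !tlift_cls // big_map mulr_sumr.
  by apply: eq_bigr => -[m y] _ /=; rewrite linearZ /= /GRing.scale /= mulrA.
have hD' : {morph @eps_pow R M l r.+1 : z w / z + w} by exact: tliftD.
by split => //; apply: (bal r.+1).
Qed.

Lemma eps_powZ (l : {linear M -> R^o}) r a (z : tpow M r) :
  eps_pow l (a *: z) = a * eps_pow l z.
Proof. by have [_ []] := eps_pow_balanced l r. Qed.

Lemma eps_pow_tpower (l : {linear M -> R^o}) (x : M) r :
  eps_pow l (tpower x r) = l x ^+ r.
Proof.
elim: r => [|r IHr] //=; rewrite tlift_pure ?IHr ?exprS //.
by have [] := eps_pow_balanced l r.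
Qed.

Lemma tpowerZ (u : R) (x : M) r : tpower (u *: x) r = u ^+ r *: tpower x r.
Proof.
elim: r => [|r IHr] /=; first by rewrite expr0 scale1r.
by rewrite IHr tpureZ scalerA -exprS -tpureZ tscale_pure.
Qed.

Lemma tpower_free (l : {linear M -> R^o}) (x : M) r (a b : R) : l x = 1 ->
  a *: tpower x r = b *: tpower x r -> a = b.
Proof.
move=> lx /(congr1 (@eps_pow R M l r)).
by rewrite !eps_powZ eps_pow_tpower lx expr1n !mulr1.
Qed.

Lemma free_coord (x : M) : (forall m, exists! a : R, m = a *: x) ->
  exists l : {linear M -> R^o}, l x = 1.
Proof.
move=> hx; pose l0 (m : M) : R^o := xget 0 [set a : R | m = a *: x].
have l0P m : m = l0 m *: x.
  have [a [ea _]] := hx m.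
  by apply: (xgetPex (0 : R) (P := [set a : R | m = a *: x])); exists a.
have uniq (a b : R) : a *: x = b *: x -> a = b.
  by move=> e; have [c [_ hc]] := hx (a *: x); rewrite -(hc a erefl) -(hc b e).
have lin : linear l0.
  move=> a m m'; apply: uniq.
  rewrite -l0P [in LHS](l0P m) [in LHS](l0P m') scalerA -scalerDl.
  by [].
pose mx := GRing.isLinear.Build R M R^o _ l0 lin.
pose l : {linear M -> R^o} := HB.pack l0 mx.
exists l; apply: uniq; rewrite scale1r; exact: esym (l0P x).
Qed.

End TensorPower.

Lemma base_change_bij (R R' : comNzRingType) (phi : {rmorphism R -> R'})
  (M : lmodType R) (N : lmodType R') (eta : {linear M -> restr phi N}) (x : M) :
  (forall m, exists! a : R, m = a *: x) ->
  (forall n : N, exists! a : R', n = a *: (eta x : N)) ->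
  bijective (tlift (fun (m : M) (a : restr phi R'^o) =>
    (a : R') *: (eta m : N))).
Proof.
move=> hx hy; set g := fun _ _ => _.
have gb : balanced g.
  rewrite /g; split=> [m m' a|m a a'|a m b].
  - by rewrite linearD scalerDr.
  - by rewrite -scalerDl.
  - rewrite linearZ /=.
    transitivity ((b : R') *: (phi a *: (eta m : N))) => //.
    by rewrite scalerA mulrC.
have hx' m : exists a : R, m = a *: x by have [a []] := hx m; exists a.
pose h (n : N) := xget 0 [set a : R' | n = a *: (eta x : N)].
have hP n : n = h n *: (eta x : N).
  by apply: (xgetPex 0 (P := [set a : R' | n = a *: (eta x : N)]));
     have [a [ea _]] := hy n; exists a.
exists (fun n => tpure x (h n : restr phi R'^o)) => [z|n].
  have [a ->] := tensor_gen hx' z; rewrite tlift_pure //; congr tpure.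
  have [c [_ hc]] := hy (g x a).
  by transitivity c; [apply/esym/hc; exact: hP | exact: hc].
by rewrite tlift_pure // /g -hP.
Qed.

Section TrModules.
Variables (K : realType) (H : discValuedHyperfieldType K).
Implicit Types (x y z t u w : H) (k i j : nat).

Lemma hmpow0 k : hmpow k (hzero : H).
Proof. by apply/hmpowP; rewrite hnorm0 ltW // thetaX_gt0. Qed.

Lemma hmpowD k x y t : hmpow k x -> hmpow k y -> (x [+] y) t -> hmpow k t.
Proof.
by move=> /hmpowP hx /hmpowP hy h; apply/hmpowP; exact: hnorm_ultra_le h hx hy.
Qed.

Lemma hmpowN k x : hmpow k x -> hmpow k ([-] x).
Proof. by move=> /hmpowP h; apply/hmpowP; rewrite hnormN. Qed.

Lemma hmpowM i j x y : hmpow i x -> hmpow j y -> hmpow (i + j) (x [*] y).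
Proof.
move=> /hmpowP hx /hmpowP hy; apply/hmpowP.
by rewrite hnormM exprD ler_pM ?hnorm_ge0.
Qed.

Lemma hmpow_one : hmpow 0 (hone : H).
Proof. by apply/hmpowP; rewrite hnorm1 expr0. Qed.

Lemma hmpow_le i j x : (i <= j)%N -> hmpow j x -> hmpow i x.
Proof. by move=> ij /hmpowP h; apply/hmpowP/(le_trans h)/thetaX_le. Qed.

Definition hmpowT k := {x : H | x \in @hmpow K H k}.

Definition tr_rel k (a b : hmpowT k) : bool :=
  hdist (\val a) (\val b) <= rho H * theta H ^+ k.

Lemma rhoX_ge0 k : 0 <= rho H * theta H ^+ k.
Proof. by apply: mulr_ge0; rewrite ltW ?rho_gt0 ?thetaX_gt0. Qed.

Lemma tr_rel_refl k : reflexive (@tr_rel k).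
Proof. by move=> a; rewrite /tr_rel hdistxx rhoX_ge0. Qed.

Lemma tr_rel_sym k : symmetric (@tr_rel k).
Proof. by move=> a b; rewrite /tr_rel hdistC. Qed.

Lemma tr_rel_trans k : transitive (@tr_rel k).
Proof. by move=> b a c; exact: hdist_ultra. Qed.

Canonical tr_equiv k :=
  EquivRel (@tr_rel k) (@tr_rel_refl k) (@tr_rel_sym k) (@tr_rel_trans k).

(* M_k = m_H^k / ~ *)
Definition trM k := {eq_quot tr_equiv k}.

HB.instance Definition _ k := Choice.on (trM k).
HB.instance Definition _ k := EqQuotient.on (trM k).

Definition hmpowT0 k : hmpowT k := exist _ hzero (mem_set (hmpow0 k)).

(* The class of x in M_k, for x in m_H^k (other x are sent to the class of 0),
   and a lift to H of an element of M_k. *)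
Definition trcls k x : trM k := \pi_(trM k) (insubd (hmpowT0 k) x).

Definition trlift k (a : trM k) : H := \val (repr a).

Lemma trlift_mem k (a : trM k) : hmpow k (trlift a).
Proof. exact/set_mem/(valP (repr a)). Qed.

Lemma trliftK k (a : trM k) : trcls k (trlift a) = a.
Proof.
by rewrite /trcls /trlift -[RHS]reprK; congr (\pi _); apply: valKd.
Qed.

Lemma trclsP k x y : hmpow k x -> hmpow k y ->
  trcls k x = trcls k y <-> hdist x y <= rho H * theta H ^+ k.
Proof.
move=> hx hy; have vx := mem_set hx; have vy := mem_set hy.
rewrite /trcls; split=> [/eqmodP|h].
  by rewrite /= /tr_rel !insubdK.
by apply/eqmodP; rewrite /= /tr_rel !insubdK.
Qed.

Lemma trclsE k x y z : hmpow k x -> hmpow k y -> (x [-] y) z ->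
  trcls k x = trcls k y <-> hnorm z <= rho H * theta H ^+ k.
Proof.
by move=> hx hy xyz; rewrite -(hdist_rho hx xyz); exact: trclsP.
Qed.

Lemma tr_ex k (a : trM k) : exists2 x, hmpow k x & a = trcls k x.
Proof. by exists (trlift a); [exact: trlift_mem | rewrite trliftK]. Qed.

Lemma hsub_add4 x y x' y' t t' w : (x [+] y) t -> (x' [+] y') t' ->
  (t [-] t') w ->
  exists u v, [/\ (x [-] x') u, (y [-] y') v & (u [+] v) w].
Proof.
move=> xyt /hoppD; rewrite haddC => h tt'.
have [s yt's xsw] := haddA_l xyt tt'.
have [v yy'v] := haddA_r h yt's; rewrite haddC => hs.
have [u xx'u uvw] := haddA_r hs xsw.
by exists u, v.
Qed.

Lemma trcls_add_wd k x y x' y' t t' :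
  hmpow k x -> hmpow k y -> hmpow k x' -> hmpow k y' ->
  trcls k x = trcls k x' -> trcls k y = trcls k y' ->
  (x [+] y) t -> (x' [+] y') t' -> trcls k t = trcls k t'.
Proof.
move=> hx hy hx' hy' ex ey xyt xyt'.
have [w tt'w] := hadd_ex t ([-] t').
have [u [v [xu yv uvw]]] := hsub_add4 xyt xyt' tt'w.
apply/(trclsE (hmpowD hx hy xyt) (hmpowD hx' hy' xyt') tt'w).
by apply: (hnorm_ultra_le uvw); [apply/(trclsE hx hx' xu) | apply/(trclsE hy hy' yv)].
Qed.

(* The class of any element of the sum of two lifts. *)
Definition tr_add k (a b : trM k) : trM k :=
  trcls k (xget hzero (trlift a [+] trlift b)).

Lemma tr_addE k x y t : hmpow k x -> hmpow k y -> (x [+] y) t ->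
  tr_add (trcls k x) (trcls k y) = trcls k t.
Proof.
move=> hx hy xyt; rewrite /tr_add; set a := trcls k x; set b := trcls k y.
have hg : (trlift a [+] trlift b) (xget hzero (trlift a [+] trlift b)).
  by apply: xgetPex; exact: hadd_ex.
by apply: trcls_add_wd hg xyt; rewrite ?trliftK //; exact: trlift_mem.
Qed.

Lemma trcls_mul_wd i j x y x' y' :
  hmpow i x -> hmpow j y -> hmpow i x' -> hmpow j y' ->
  trcls i x = trcls i x' -> trcls j y = trcls j y' ->
  trcls (i + j) (x [*] y) = trcls (i + j) (x' [*] y').
Proof.
move=> hx hy hx' hy' /(trclsP hx hx') ex /(trclsP hy hy') ey.
apply/(trclsP (hmpowM hx hy) (hmpowM hx' hy')).
apply: (@hdist_ultra _ _ _ (x [*] y')).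
  rewrite hdistM exprD mulrCA; apply: ler_pM; rewrite ?hnorm_ge0 ?hdist_ge0 //.
  exact/hmpowP.
rewrite !(hmulC _ y') hdistM exprD mulrA mulrC.
by apply: ler_pM; rewrite ?hnorm_ge0 ?hdist_ge0 //; exact/hmpowP.
Qed.

(* Products of lifts, M_i x M_j -> M_(i+j). *)
Definition tr_mul i j (a : trM i) (b : trM j) : trM (i + j) :=
  trcls (i + j) (trlift a [*] trlift b).

Lemma tr_mulE i j x y : hmpow i x -> hmpow j y ->
  tr_mul (trcls i x) (trcls j y) = trcls (i + j) (x [*] y).
Proof.
by move=> hx hy; apply: trcls_mul_wd; rewrite ?trliftK //; exact: trlift_mem.
Qed.

Definition tr_opp k (a : trM k) : trM k := trcls k ([-] trlift a).

Lemma tr_addA k : associative (@tr_add k).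
Proof.
move=> a b c; have [x hx ->] := tr_ex a; have [y hy ->] := tr_ex b.
have [z hz ->] := tr_ex c; have [t xyt] := hadd_ex x y.
have [w tzw] := hadd_ex t z; have [s yzs xsw] := haddA_l xyt tzw.
rewrite (tr_addE hx hy xyt) (tr_addE hy hz yzs).
by rewrite (tr_addE (hmpowD hx hy xyt) hz tzw) (tr_addE hx (hmpowD hy hz yzs) xsw).
Qed.

Lemma tr_addC k : commutative (@tr_add k).
Proof. by move=> a b; rewrite /tr_add haddC. Qed.

Lemma tr_add0 k : left_id (trcls k hzero) (@tr_add k).
Proof.
move=> a; have [x hx ->] := tr_ex a.
by apply: tr_addE => //; [exact: hmpow0 | exact/h0addP].
Qed.

Lemma tr_addN k : left_inverse (trcls k hzero) (@tr_opp k) (@tr_add k).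
Proof.
move=> a; rewrite tr_addC -{1}[a]trliftK; apply: tr_addE.
- exact: trlift_mem.
- by apply: hmpowN; exact: trlift_mem.
- exact: hsubxx.
Qed.

HB.instance Definition _ k := GRing.isZmodule.Build (trM k)
  (@tr_addA k) (@tr_addC k) (@tr_add0 k) (@tr_addN k).

(* The ring R = M_0; note that 0 + k reduces to k. *)
Definition trR := trM 0.

HB.instance Definition _ := GRing.Zmodule.on trR.

Definition trR_mul (a b : trR) : trR := tr_mul a b.

Definition tr_scale k (a : trR) (b : trM k) : trM k := tr_mul a b.

Lemma trclsD k x y t : hmpow k x -> hmpow k y -> (x [+] y) t ->
  trcls k x + trcls k y = trcls k t.
Proof. exact: tr_addE. Qed.

Lemma tr_scaleE k x y : hmpow 0 x -> hmpow k y ->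
  tr_scale (trcls 0 x) (trcls k y) = trcls k (x [*] y).
Proof. by move=> hx hy; rewrite /tr_scale tr_mulE. Qed.

Lemma tr_scaleA0 k (a b : trR) (c : trM k) :
  tr_scale a (tr_scale b c) = tr_scale (trR_mul a b) c.
Proof.
have [x hx ->] := tr_ex a; have [y hy ->] := tr_ex b; have [z hz ->] := tr_ex c.
have hyz : hmpow k (y [*] z) := hmpowM hy hz.
have hxy : hmpow 0 (x [*] y) := hmpowM hx hy.
have -> : trR_mul (trcls 0 x) (trcls 0 y) = trcls 0 (x [*] y) by exact: (@tr_mulE 0 0 _ _ hx hy).
by rewrite (tr_scaleE hy hz) (tr_scaleE hx hyz) (tr_scaleE hxy hz) hmulA.
Qed.

Lemma tr_scale1 k : left_id (trcls 0 hone : trR) (@tr_scale k).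
Proof.
move=> a; have [x hx ->] := tr_ex a.
by rewrite tr_scaleE ?hmul1 //; exact: hmpow_one.
Qed.

Lemma tr_scaleDr k (a : trR) : {morph @tr_scale k a : b c / b + c}.
Proof.
move=> b c; have [z hz ->] := tr_ex a; have [x hx ->] := tr_ex b.
have [y hy ->] := tr_ex c; have [t xyt] := hadd_ex x y.
rewrite (trclsD hx hy xyt) (tr_scaleE hz hx) (tr_scaleE hz hy).
rewrite (tr_scaleE hz (hmpowD hx hy xyt)); apply/esym.
exact: (trclsD (hmpowM hz hx) (hmpowM hz hy) (hmulD_l z xyt)).
Qed.

Lemma tr_scaleDl k (c : trM k) : {morph (@tr_scale k)^~ c : a b / a + b}.
Proof.
move=> a b; have [z hz ->] := tr_ex c; have [x hx ->] := tr_ex a.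
have [y hy ->] := tr_ex b; have [t xyt] := hadd_ex x y.
rewrite (trclsD hx hy xyt) (tr_scaleE hx hz) (tr_scaleE hy hz).
rewrite (tr_scaleE (hmpowD hx hy xyt) hz); apply/esym.
exact: (trclsD (hmpowM hx hz) (hmpowM hy hz) (hmulD _ _ z _ xyt)).
Qed.

Lemma trR_mulA : associative trR_mul.
Proof. by move=> a b c; exact: tr_scaleA0. Qed.

Lemma trR_mulC : commutative trR_mul.
Proof. by move=> a b; rewrite /trR_mul /tr_mul hmulC. Qed.

Lemma trR_mul1 : left_id (trcls 0 hone) trR_mul.
Proof. exact: (@tr_scale1 0). Qed.

Lemma trR_mulDl : left_distributive trR_mul +%R.
Proof. by move=> a b c; exact: tr_scaleDl. Qed.

Lemma trcls_eq0 k x : hmpow k x ->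
  trcls k x = 0 <-> hnorm x <= rho H * theta H ^+ k.
Proof.
move=> hx; apply: (trclsE hx (hmpow0 k)).
by rewrite hopp0; exact/hadd0P.
Qed.

Lemma trR_one_neq0 : (trcls 0 hone : trR) != 0.
Proof.
apply/eqP => /(trcls_eq0 hmpow_one).
by rewrite hnorm1 expr0 mulr1 leNgt rho_lt1.
Qed.

HB.instance Definition _ := GRing.Zmodule_isComNzRing.Build trR
  trR_mulA trR_mulC trR_mul1 trR_mulDl trR_one_neq0.

HB.instance Definition _ k := GRing.Zmodule_isLmodule.Build trR (trM k)
  (@tr_scaleA0 k) (@tr_scale1 k) (@tr_scaleDr k) (@tr_scaleDl k).

Lemma trclsM x y : hmpow 0 x -> hmpow 0 y ->
  (trcls 0 x : trR) * trcls 0 y = trcls 0 (x [*] y).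
Proof. exact: tr_scaleE. Qed.

Lemma trclsZ k x y : hmpow 0 x -> hmpow k y ->
  (trcls 0 x : trR) *: trcls k y = trcls k (x [*] y).
Proof. exact: tr_scaleE. Qed.

Lemma trcls1 : (1 : trR) = trcls 0 hone. Proof. by []. Qed.

Lemma hdivP k x p : hnorm p = theta H ^+ k -> hmpow k x ->
  hmpow 0 (x [*] hinv p) /\ x = (x [*] hinv p) [*] p.
Proof.
move=> np hx.
have p0 : p <> hzero by apply: hnorm_gt0N; rewrite np thetaX_gt0.
split; last by rewrite -hmulA [hinv p [*] p]hmulC hmulV // hmul1r.
apply/hmpowP; rewrite expr0 hnormM hnormV // np ler_pdivrMr ?thetaX_gt0 // mul1r.
exact/hmpowP.
Qed.

Lemma tr_basis k p : hnorm p = theta H ^+ k ->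
  forall m : trM k, exists! a : trR, m = a *: trcls k p.
Proof.
move=> np m; have hp : hmpow k p by apply/hmpowP; rewrite np.
have [x hx ->] := tr_ex m; have [hq xq] := hdivP np hx.
exists (trcls 0 (x [*] hinv p)); split; first by rewrite trclsZ // -xq.
move=> b; have [y hy ->] := tr_ex b; rewrite trclsZ //.
have hyp : hmpow k (y [*] p) := hmpowM hy hp.
move/(trclsP hx hyp); rewrite {1}xq !(hmulC _ p) hdistM np [rho H * _]mulrC.
rewrite ler_pM2l ?thetaX_gt0 // => h.
by apply/(trclsP _ hy); rewrite // ?expr0 ?mulr1 // hmulC.
Qed.

Lemma tr_free_rank1 k : free_rank1 (trM k).
Proof. by exists (trcls k (hexp (unif H) k)); apply: tr_basis; exact: hnorm_unifX. Qed.

Definition tr_inc (a : trM 1) : trR := trcls 0 (trlift a).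

Lemma tr_incE x : hmpow 1 x -> tr_inc (trcls 1 x) = trcls 0 x.
Proof.
move=> hx; have hl := trlift_mem (trcls 1 x).
apply/(trclsP (hmpow_le (leq0n 1) hl) (hmpow_le (leq0n 1) hx)).
have : trcls 1 (trlift (trcls 1 x)) = trcls 1 x by rewrite trliftK.
move/(trclsP hl hx) => h; apply: (le_trans h).
by rewrite ler_pM2l ?rho_gt0 // thetaX_le.
Qed.

Lemma tr_inc_linear : linear (tr_inc : trM 1 -> trR^o).
Proof.
move=> a b c; have [z hz ->] := tr_ex a; have [x hx ->] := tr_ex b.
have [y hy ->] := tr_ex c.
have hzx : hmpow 1 (z [*] x) := hmpowM hz hx.
have [t zxyt] := hadd_ex (z [*] x) y.
rewrite trclsZ // (trclsD hzx hy zxyt) !tr_incE //; last exact: hmpowD zxyt.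
have w1 u : hmpow 1 u -> hmpow 0 u by exact: hmpow_le.
have -> : (trcls 0 z : trR) *: (trcls 0 x : trR^o) = trcls 0 (z [*] x).
  exact: trclsM hz (w1 _ hx).
exact/esym/(trclsD (w1 _ hzx) (w1 _ hy) zxyt).
Qed.

HB.instance Definition _ :=
  GRing.isLinear.Build trR (trM 1) trR^o _ tr_inc tr_inc_linear.

Lemma tr_unit x : hmpow 0 x -> 1 <= hnorm x ->
  exists b : trR, b * trcls 0 x = 1.
Proof.
move=> hx x1; have nx : hnorm x = 1.
  by apply/eqP; rewrite eq_le x1 andbT; have /hmpowP := hx; rewrite expr0.
have x0 : x <> hzero by apply: hnorm_gt0N; rewrite nx.
have hi : hmpow 0 (hinv x) by apply/hmpowP; rewrite expr0 hnormV // nx invr1.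
by exists (trcls 0 (hinv x)); rewrite trclsM // hmulC hmulV.
Qed.

Lemma tr_inc_range : range tr_inc = [set a : trR | exists2 x, hnorm x < 1 & a = trcls 0 x].
Proof.
apply/seteqP; split=> a.
  move=> [b _ <-]; have [x hx ->] := tr_ex b; exists x; last exact: tr_incE.
  have /hmpowP := hx; rewrite expr1 => h; exact: le_lt_trans h (theta_lt1 H).
move=> [x x1 ->]; have hx : hmpow 1 x.
  by apply/hmpowP; rewrite expr1; exact: theta_max.
by exists (trcls 1 x) => //; exact: tr_incE.
Qed.

Lemma tr_lt1N (I : set trR) : is_submod (I : set trR^o) -> I <> setT ->
  I `<=` range tr_inc.
Proof.
move=> [I0 IS] IT a Ia; rewrite tr_inc_range; have [x hx ax] := tr_ex a.
exists x => //; rewrite ltNge; apply/negP => x1; apply: IT.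
have [b hb] := tr_unit hx x1; apply/seteqP; split => // c _.
have := IS (c * b) a 0 Ia I0; rewrite addr0.
by rewrite /GRing.scale /= ax -mulrA hb mulr1.
Qed.

Lemma tr_inc_maximal : maximal_ideal (range tr_inc).
Proof.
have sub : is_submod (range tr_inc : set trR^o).
  split; first by exists 0 => //; exact: linear0.
  move=> a _ _ [x _ <-] [y _ <-]; exists (a *: x + y) => //; exact: linearP.
have nT : range tr_inc <> setT.
  move=> e; have : (range tr_inc) (1 : trR) by rewrite e.
  rewrite tr_inc_range => -[x x1] /(trclsP hmpow_one).
  have hx : hmpow 0 x by apply/hmpowP; rewrite expr0 ltW.
  move/(_ hx); rewrite expr0 mulr1 => h.
  have : hdist (hone : H) hzero <= Num.max (rho H) (hnorm x).
    apply: (@hdist_ultra _ _ _ x); first by rewrite le_max h.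
    by rewrite hdistC hdist0x le_max lexx orbT.
  by rewrite hdistC hdist0x hnorm1 leNgt gt_max rho_lt1 x1.
split => // J sJ IJ; have [->|nJ] := pselect (J = setT); first by right.
by left; apply/seteqP; split => //; exact: tr_lt1N.
Qed.

Lemma tr_inc_unique J : maximal_ideal J -> J = range tr_inc.
Proof.
move=> [sJ nJ mJ]; have h := tr_lt1N sJ nJ.
have [sI nI _] := tr_inc_maximal.
by have [->//|e] := mJ _ sI h; case: nI.
Qed.

Lemma tr_inc_principal :
  range tr_inc = range (fun a : trR => a * trcls 0 (unif H)).
Proof.
have hu : hmpow 1 (unif H) by apply/hmpowP; rewrite expr1 hnorm_unif.
have e1 : tr_inc (trcls 1 (unif H)) = trcls 0 (unif H) by exact: tr_incE.
have nu : hnorm (unif H) = theta H ^+ 1 by rewrite expr1 hnorm_unif.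
apply/seteqP; split => _ [a _ <-].
  have [b [-> _]] := tr_basis nu a; exists b => //.
  by rewrite linearZ /= e1.
by exists (a *: trcls 1 (unif H)) => //; rewrite linearZ /= e1.
Qed.

Lemma tr_ideal (I : set trR) : is_submod (I : set trR^o) ->
  exists2 j, I (trcls 0 (hexp (unif H) j)) &
  I = range (fun a : trR => a * trcls 0 (hexp (unif H) j)).
Proof.
move=> [I0 IS]; pose pj j : trR := trcls 0 (hexp (unif H) j).
have hpj j : hmpow 0 (hexp (unif H) j).
  by apply/hmpowP; rewrite hnorm_unifX thetaX_le.
have hex : exists j, `[< I (pj j) >].
  have [m _ [rm _]] := rho_ex H; exists m; apply/asboolP.
  have -> // : pj m = 0.
  by apply/trcls_eq0; rewrite // hnorm_unifX rm expr0 mulr1.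
case: (ex_minnP hex) => j /asboolP Ij jmin; exists j => //.
have mulI a : I (a * pj j).
  by have := IS a _ _ Ij I0; rewrite addr0.
apply/seteqP; split => [a Ia|_ [a _ <-]]; last exact: mulI.
have [x hx ax] := tr_ex a.
have [x0|/eqP x0] := eqVneq x hzero.
  by exists 0 => //; rewrite mul0r ax x0.
have x1 : hnorm x <= 1 by have /hmpowP := hx; rewrite expr0.
have [n xn] := hnormP x0 x1.
have jn : (j <= n)%N.
  apply: jmin; apply/asboolP.
  have hn : hmpow n (hexp (unif H) n) by apply/hmpowP; rewrite hnorm_unifX.
  have [hq e] := hdivP xn hn.
  have := IS (trcls 0 (hexp (unif H) n [*] hinv x)) a 0 Ia I0.
  by rewrite addr0 /GRing.scale /= ax trclsM // -e.
have hxj : hmpow j x by apply/hmpowP; rewrite xn thetaX_le.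
have [hq e] := hdivP (hnorm_unifX H j) hxj.
by exists (trcls 0 (x [*] hinv (hexp (unif H) j))) => //; rewrite trclsM // -e.
Qed.

Lemma tr_artinian : artinian (trR^o).
Proof.
move=> N sN dN; pose pj j : trR := trcls 0 (hexp (unif H) j).
have dN' i n : (i <= n)%N -> N n `<=` N i.
  elim: n => [|n IHn]; first by rewrite leqn0 => /eqP ->.
  rewrite leq_eqVlt => /predU1P[-> //|] /IHn h.
  exact: subset_trans (dN n) h.
have hex : exists j, `[< exists n, N n (pj j) >].
  by have [j Nj _] := tr_ideal (sN 0%N); exists j; apply/asboolP; exists 0%N.
have [m _ [rm _]] := rho_ex H.
have pm0 : pj m = 0.
  have hm : hmpow 0 (hexp (unif H) m).
    by apply/hmpowP; rewrite hnorm_unifX thetaX_le.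
  by apply/trcls_eq0; rewrite // hnorm_unifX rm expr0 mulr1.
have hex' : exists j, `[< exists n, forall i, (n <= i)%N -> N i (pj j) >].
  by exists m; apply/asboolP; exists 0%N => i _; rewrite pm0; case: (sN i).
case: (ex_minnP hex') => j /asboolP[n0 hj] jmin.
have nj j' : (j' < j)%N -> exists n, ~ N n (pj j').
  move=> j'j; apply: contrapT => h.
  have : (j <= j')%N.
    apply: jmin; apply/asboolP; exists 0%N => i _; apply: contrapT => ni.
    by apply: h; exists i.
  by rewrite leqNgt j'j.
have [n1 hn1] : exists n, forall j', (j' < j)%N -> ~ N n (pj j').
  have : forall q, (q <= j)%N -> exists n, forall j', (j' < q)%N -> ~ N n (pj j').
    elim=> [|q IHq] qj; first by exists 0%N.
    have [n hn] := IHq (ltnW qj); have [n' hn'] := nj q qj.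
    exists (maxn n n') => j'; rewrite ltnS leq_eqVlt => /predU1P[->|/hn h] hN.
      by apply: hn'; apply: dN' hN; exact: leq_maxr.
    by apply: h; apply: dN' hN; exact: leq_maxl.
  by apply.
exists (maxn n0 n1) => i hi; apply/seteqP; split; first exact: dN'.
have [j1 hj1 ->] := tr_ideal (sN (maxn n0 n1)).
have jj1 : (j <= j1)%N.
  rewrite leqNgt; apply/negP => /hn1; apply; apply: dN' hj1; exact: leq_maxr.
have Nij : N i (pj j) by apply: hj; exact: leq_trans (leq_maxl _ _) hi.
have [Ni0 NiS] := sN i.
move=> _ [a _ <-].
have := NiS (a * pj (j1 - j)%N) _ _ Nij Ni0; rewrite addr0.
have hX q : hmpow 0 (hexp (unif H) q).
  by apply/hmpowP; rewrite hnorm_unifX thetaX_le.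
by rewrite /GRing.scale /= -mulrA trclsM // -hexpD subnK.
Qed.

Lemma tr_truncated_dvr : truncated_dvr trR.
Proof.
split; first exact: tr_artinian.
exists (range tr_inc); split; first exact: tr_inc_maximal.
  exact: tr_inc_unique.
by exists (trcls 0 (unif H)); exact: tr_inc_principal.
Qed.

Definition Tr : triple :=
  @Triple trR (trM 1) tr_inc tr_truncated_dvr (@tr_free_rank1 1) tr_inc_maximal.

(* The identification M_k -> M^{(x) k}, [pi^k] |-> [pi]^{(x) k}; by
   tr_ident_unif it does not depend on the uniformizer. *)
Definition tr_ident k (z : trM k) : tpow (trM 1) k :=
  xget 0 [set a : trR | z = a *: trcls k (hexp (unif H) k)]
    *: tpower (trcls 1 (unif H)) k.

Lemma tr_identE k (a : trR) :
  tr_ident (a *: trcls k (hexp (unif H) k)) = a *: tpower (trcls 1 (unif H)) k.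
Proof.
rewrite /tr_ident; congr (_ *: _).
have [c [_ hc]] := tr_basis (hnorm_unifX H k) (a *: trcls k (hexp (unif H) k)).
by apply: xget_unique => // b hb; rewrite -(hc a erefl) (hc b hb).
Qed.

Lemma tr_ident_linear k : linear (@tr_ident k).
Proof.
move=> a z w.
have [b [-> _]] := tr_basis (hnorm_unifX H k) z.
have [c [-> _]] := tr_basis (hnorm_unifX H k) w.
by rewrite scalerA -scalerDl !tr_identE scalerA -scalerDl.
Qed.

Lemma tr_ident_unif k p : uniformizer p ->
  tr_ident (trcls k (hexp p k)) = tpower (trcls 1 p) k.
Proof.
move=> up; have hp : hmpow 1 p by apply/hmpowP; rewrite expr1 up.
have nu : hnorm (unif H) = theta H ^+ 1 by rewrite expr1 hnorm_unif.
have [hq e] := hdivP nu hp; set u := p [*] hinv _ in hq e.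
have hpi : hmpow 1 (unif H) by apply/hmpowP; rewrite nu.
have hX j : hmpow 0 (hexp u j) by elim: j => [|j IH]; [exact: hmpow_one | exact: (hmpowM hq IH)].
have huk : hmpow k (hexp (unif H) k) by apply/hmpowP; rewrite hnorm_unifX.
have eX j : hexp p j = hexp u j [*] hexp (unif H) j.
  elim: j => [|j IH]; first by rewrite hmul1.
  rewrite !hexpS IH {1}e -!hmulA; congr (_ [*] _).
  congr (_ [*] _); by rewrite !hmulA [unif H [*] hexp u j]hmulC.
have uX j : (trcls 0 u : trR) ^+ j = trcls 0 (hexp u j).
  elim: j => [|j IH]; first by rewrite expr0.
  by rewrite exprS IH trclsM.
rewrite eX -trclsZ // tr_identE [p in RHS]e -trclsZ // tpowerZ uX //.
Qed.

End TrModules.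

Section MorphismTheory.
Variables (K : realType) (H H' : valuedHyperfieldType K) (f : vhMorphism H H').

Lemma vhmap1 : f hone = hone.
Proof.
have e : f hone = f hone [*] f hone by rewrite -vhmapM hmul1.
have n0 : f hone <> hzero.
  by apply: hnorm_gt0N; rewrite vhmap_norm hnorm1 ltr01.
by rewrite -{1}(hmulV n0) {2}e -hmulA hmulV // hmul1r.
Qed.

Lemma vhmap0 : f hzero = hzero.
Proof. by apply/hnorm_eq0; rewrite vhmap_norm hnorm0. Qed.

Lemma vhmap_add x y z : (x [+] y) z -> (f x [+] f y) (f z).
Proof.
move=> xyz; have : (hadds (f @^-1` [set f x]) (f @^-1` [set f y])) z.
  by exists x => //; exists y.
by rewrite -vhmapD; [| exists x | exists y].
Qed.

Lemma vhmapN x : f ([-] x) = [-] (f x).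
Proof.
by apply/haddN; rewrite -vhmap0; apply: vhmap_add; exact: hsubxx.
Qed.

Lemma vhmap_hdist x y : hdist (f x) (f y) <= hdist x y.
Proof.
have [->|/eqP xy] := eqVneq x y; first by rewrite !hdistxx.
have [w xyw] := hadd_ex x ([-] y); rewrite (hdistE xy xyw) -(vhmap_norm f).
by apply: hdist_le; rewrite -vhmapN; exact: vhmap_add.
Qed.

End MorphismTheory.

Section TrMorphism.
Variables (K : realType) (H H' : discValuedHyperfieldType K).
Variable f : vhMorphism H H'.

Lemma rho_map : rho H <= rho H'.
Proof.
have [m _ [rm h1]] := rho_ex H.
have h : (hone [-] hone : set H) (hexp (unif H) m) by apply/h1; rewrite hnorm_unifX.
have := vhmap_add f h; rewrite vhmapN vhmap1 => /rho_sub1.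
by rewrite vhmap_norm hnorm_unifX rm.
Qed.

(* r = log theta_H / log theta_H', which is a natural number by ram_degE. *)
Definition ram_deg : nat := Num.truncn (ln (theta H) / ln (theta H')).

Lemma theta_map : exists2 n, (0 < n)%N & theta H = theta H' ^+ n.
Proof.
have [n hn] : exists n, theta H = theta H' ^+ n.
  rewrite -hnorm_unif -(vhmap_norm f); apply: hnormP.
    by apply: hnorm_gt0N; rewrite vhmap_norm hnorm_unif theta_gt0.
  by rewrite vhmap_norm hnorm_unif ltW // theta_lt1.
exists n => //; case: n hn => // hn.
by have := theta_lt1 H; rewrite hn expr0 ltxx.
Qed.

Lemma ln_theta_neq0 : ln (theta H') != 0.
Proof. by rewrite lt_eqF // ln_lt0 // theta_gt0 theta_lt1. Qed.

Lemma ram_degE : ram_deg%:R = ln (theta H) / ln (theta H').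
Proof.
rewrite /ram_deg; have [n _ ->] := theta_map.
by rewrite lnXn ?theta_gt0 // -[ln _ *+ _]mulr_natl mulfK ?ln_theta_neq0 // natrK.
Qed.

Lemma theta_ram : theta H = theta H' ^+ ram_deg.
Proof.
rewrite /ram_deg; have [n _ hn] := theta_map; rewrite {1 2}hn.
by rewrite lnXn ?theta_gt0 // -[ln _ *+ _]mulr_natl mulfK ?ln_theta_neq0 // natrK.
Qed.

Lemma hmpow_map k x : hmpow k x -> hmpow (ram_deg * k) (f x).
Proof. by move=> /hmpowP h; apply/hmpowP; rewrite vhmap_norm exprM -theta_ram. Qed.

Lemma hmpow_map0 x : hmpow 0 x -> hmpow 0 (f x).
Proof. by move=> /hmpow_map; rewrite muln0. Qed.

Lemma hmpow_map1 x : hmpow 1 x -> hmpow ram_deg (f x).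
Proof. by move=> /hmpow_map; rewrite muln1. Qed.

Definition tr_phi (a : trR H) : trR H' := trcls 0 (f (trlift a)).

Definition tr_map1 (a : trM H 1) : trM H' ram_deg := trcls ram_deg (f (trlift a)).

Lemma tr_phiE x : hmpow 0 x -> tr_phi (trcls 0 x) = trcls 0 (f x).
Proof.
move=> hx; have hl := trlift_mem (trcls 0 x).
apply/(trclsP (hmpow_map0 hl) (hmpow_map0 hx)).
have : trcls 0 (trlift (trcls 0 x)) = trcls 0 x by rewrite trliftK.
move/(trclsP hl hx) => h; apply: le_trans (vhmap_hdist f _ _) (le_trans h _).
by rewrite !expr0 !mulr1 rho_map.
Qed.

Lemma tr_map1E x : hmpow 1 x -> tr_map1 (trcls 1 x) = trcls ram_deg (f x).
Proof.
move=> hx; have hl := trlift_mem (trcls 1 x).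
apply/(trclsP (hmpow_map1 hl) (hmpow_map1 hx)).
have : trcls 1 (trlift (trcls 1 x)) = trcls 1 x by rewrite trliftK.
move/(trclsP hl hx) => h; apply: le_trans (vhmap_hdist f _ _) (le_trans h _).
by rewrite expr1 -theta_ram ler_pM2r ?theta_gt0 // rho_map.
Qed.

Lemma tr_phi_zmod : zmod_morphism tr_phi.
Proof.
have D : {morph tr_phi : a b / a + b}.
  move=> a b; have [x hx ->] := tr_ex a; have [y hy ->] := tr_ex b.
  have [t xyt] := hadd_ex x y.
  rewrite (trclsD hx hy xyt) !tr_phiE //; last exact: hmpowD xyt.
  exact/esym/(trclsD (hmpow_map0 hx) (hmpow_map0 hy))/vhmap_add.
by move=> a b; apply: (addIr (tr_phi b)); rewrite -D !subrK.
Qed.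

Lemma tr_phi_monoid : monoid_morphism tr_phi.
Proof.
split=> [|a b].
  by rewrite [1]trcls1 tr_phiE ?vhmap1 //; exact: hmpow_one.
have [x hx ->] := tr_ex a; have [y hy ->] := tr_ex b.
have hxy : hmpow 0 (x [*] y) := hmpowM hx hy.
rewrite (trclsM hx hy) !tr_phiE // vhmapM.
exact/esym/(trclsM (hmpow_map0 hx) (hmpow_map0 hy)).
Qed.

HB.instance Definition _ :=
  GRing.isZmodMorphism.Build (trR H) (trR H') tr_phi tr_phi_zmod.
HB.instance Definition _ :=
  GRing.isMonoidMorphism.Build (trR H) (trR H') tr_phi tr_phi_monoid.

Definition tr_phi_rmorph : {rmorphism trR H -> trR H'} := tr_phi.

Definition tr_eta (a : trM H 1) :
    restr tr_phi_rmorph (tpow (trM H' 1) ram_deg) :=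
  tr_ident (tr_map1 a).

Lemma tr_eta_linear : linear tr_eta.
Proof.
move=> a b c; have [z hz ->] := tr_ex a; have [x hx ->] := tr_ex b.
have [y hy ->] := tr_ex c; rewrite /tr_eta.
have hzx : hmpow 1 (z [*] x) := hmpowM hz hx.
have [t zxyt] := hadd_ex (z [*] x) y.
rewrite trclsZ // (trclsD hzx hy zxyt) !tr_map1E //; last exact: hmpowD zxyt.
rewrite -(trclsD (hmpow_map1 hzx) (hmpow_map1 hy) (vhmap_add f zxyt)) vhmapM.
rewrite -(trclsZ (hmpow_map0 hz) (hmpow_map1 hx)) -tr_phiE //.
exact: tr_ident_linear.
Qed.

HB.instance Definition _ := GRing.isLinear.Build (trR H) (trM H 1)
  (restr tr_phi_rmorph (tpow (trM H' 1) ram_deg)) _ tr_eta tr_eta_linear.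

Lemma tr_compat (a : trM H 1) :
  tr_phi_rmorph (tr_inc a) = eps_pow (@tr_inc K H') (tr_eta a).
Proof.
have [x hx ->] := tr_ex a.
have hx0 : hmpow 0 x by exact: hmpow_le hx.
rewrite tr_incE // /tr_eta tr_map1E //= tr_phiE //.
have [hq e] := hdivP (hnorm_unifX H' ram_deg) (hmpow_map1 hx).
have hr : hmpow ram_deg (hexp (unif H') ram_deg).
  by apply/hmpowP; rewrite hnorm_unifX.
rewrite {2}e -(trclsZ hq hr) tr_identE eps_powZ eps_pow_tpower.
have hu : hmpow 1 (unif H') by apply/hmpowP; rewrite hnorm_unif expr1.
have hX j : hmpow 0 (hexp (unif H') j).
  by apply/hmpowP; rewrite hnorm_unifX thetaX_le.
have eX j : (trcls 0 (unif H') : trR H') ^+ j = trcls 0 (hexp (unif H') j).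
  elim: j => [|j IH]; first by rewrite expr0.
  rewrite exprS IH trclsM //; exact: hmpow_le hu.
by rewrite /= tr_incE // eX trclsM // -e.
Qed.

Lemma tr_bij : bijective
  (tlift (fun (x : trM H 1) (a : restr tr_phi_rmorph (trR H')^o) =>
     (a : trR H') *: (tr_eta x : tpow (trM H' 1) ram_deg))).
Proof.
have nu : hnorm (unif H) = theta H ^+ 1 by rewrite expr1 hnorm_unif.
have hu : hmpow 1 (unif H) by apply/hmpowP; rewrite nu.
have nu' : hnorm (unif H') = theta H' ^+ 1 by rewrite expr1 hnorm_unif.
apply: (base_change_bij (eta := tr_eta) (tr_basis nu)) => n.
have nfu : hnorm (f (unif H)) = theta H' ^+ ram_deg.
  by rewrite vhmap_norm hnorm_unif theta_ram.
have [l hl] := free_coord (tr_basis nu').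
have hg m : exists a : trR H', m = a *: trcls 1 (unif H').
  by have [a []] := tr_basis nu' m; exists a.
rewrite /= /tr_eta tr_map1E //.
set w := tr_ident _.
have identZ (a : trR H') z : tr_ident (a *: z) = a *: @tr_ident K H' ram_deg z.
  have := tr_ident_linear a z 0; rewrite addr0 => ->.
  have -> : tr_ident (0 : trM H' ram_deg) = 0.
    rewrite -(scale0r (trcls ram_deg (hexp (unif H') ram_deg))) tr_identE.
    exact: scale0r.
  by rewrite addr0.
have [c ec] : exists c : trR H', c *: w = tpower (trcls 1 (unif H')) ram_deg.
  have [c [hc _]] := tr_basis nfu (trcls ram_deg (hexp (unif H') ram_deg)).
  by exists c; rewrite /w -identZ -hc -[X in tr_ident X]scale1r tr_identE scale1r.
have [d ed] := tpower_gen hg w.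
have [b eb] := tpower_gen hg n.
exists (b * c); split; first by rewrite eb -ec scalerA.
move=> b' eb'.
have e1 : b' * d = b.
  by apply: (tpower_free hl (r := ram_deg)); rewrite -scalerA -ed -eb' eb.
have e2 : c * d = 1.
  apply: (tpower_free hl (r := ram_deg)); rewrite -scalerA -ed ec.
  by rewrite scale1r.
by rewrite -e1 -mulrA [d * c]mulrC e2 mulr1.
Qed.

Definition Tr_mor : tripleMorphism (Tr H) (Tr H') :=
  @TripleMorphism (Tr H) (Tr H') ram_deg tr_phi_rmorph tr_eta tr_compat tr_bij.

End TrMorphism.

(* Main.v *)
(** Both properties transfer separately.  The ideals of R = Tr(H) are generated
    by the powers of the uniformizer, so l(R) is the m with rho_H = theta_H^m;
    since theta_H = theta_H'^r, the equality l(R') = r l(R) says that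
    rho_H = rho_H'.  Reducing a sum representation in O_H' modulo ~ gives
    generators of R' over R.  Conversely, an element of O_H' of absolute value
    1 is determined by its class in R', so if the t generate R' over R then
    every such element lies in a sum of multiples of lifts of the t; a general
    element has the absolute value of f(pi)^q pi'^k with k < r, so the lifts
    multiplied by the pi'^k, k < r, generate O_H'. *)
Require Import Defs.
From HB Require Import structures.
From mathcomp Require Import all_boot all_order all_algebra reals.
From mathcomp Require Import boolp classical_sets.

Set Implicit Arguments.
Unset Strict Implicit.
Unset Printing Implicit Defensive.

Import Order.TTheory GRing.Theory Num.Theory.

Local Open Scope classical_set_scope.
Local Open Scope ring_scope.
Local Open Scope hyper_scope.

(** * Iterated hyperfield sums *)

Section HyperSums.
Variable H : hyperfieldType.

Lemma haddsP (A B : set H) z :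
  hadds A B z <-> exists x y, [/\ A x, B y & (x [+] y) z].
Proof.
split=> [[x Ax [y By xyz]]|[x [y [Ax By xyz]]]]; first by exists x, y.
by exists x => //; exists y.
Qed.

Lemma haddsA : associative (@hadds H).
Proof.
move=> A B C; apply/seteqP; split=> w /haddsP[x [y [hx hy xyw]]].
  have /haddsP[b [c [Bb Cc bcy]]] := hy.
  have [t xbt tcw] := haddA_r bcy xyw.
  by apply/haddsP; exists t, c; split => //; apply/haddsP; exists x, b.
have /haddsP[a [b [Aa Bb abx]]] := hx.
have [s bys asw] := haddA_l abx xyw.
by apply/haddsP; exists a, s; split => //; apply/haddsP; exists b, y.
Qed.

Lemma haddsC : commutative (@hadds H).
Proof.
move=> A B; apply/seteqP; split=> w /haddsP[x [y [hx hy xyw]]];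
  by apply/haddsP; exists y, x; rewrite haddC.
Qed.

Lemma hadd0s : left_id [set (hzero : H)] (@hadds H).
Proof.
move=> A; apply/seteqP; split=> w.
  by move=> /haddsP[_ [y [-> Ay /h0addP ->]]].
by move=> Aw; apply/haddsP; exists hzero, w; split => //; exact/h0addP.
Qed.

(** Makes the generic big-operator lemmas on splitting and reordering available for iterated
    hyperfield sums. *)
HB.instance Definition _ :=
  Monoid.isComLaw.Build (set H) [set hzero] (@hadds H) haddsA haddsC hadd0s.

Lemma hsum_ex (I : Type) (s : seq I) (g : I -> H) :
  exists z, (\big[@hadds H/[set hzero]]_(i <- s) [set g i]) z.
Proof.
elim: s => [|i s [z hz]]; first by exists hzero; rewrite big_nil.
have [t it] := hadd_ex (g i) z.
by exists t; rewrite big_cons; apply/haddsP; exists (g i), z.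
Qed.

Lemma hmulI (w : H) : w <> hzero -> injective (hmul w).
Proof.
move=> w0 x y e; rewrite -[x]hmul1 -[y]hmul1 -(hmulV w0).
by rewrite [w [*] hinv w]hmulC -!hmulA e.
Qed.

End HyperSums.

Section ValuedSums.
Variables (K : realType) (H : valuedHyperfieldType K).

Lemma hsumM (I : Type) (s : seq I) (g : I -> H) (w z : H) :
  (\big[@hadds H/[set hzero]]_(i <- s) [set g i]) z ->
  (\big[@hadds H/[set hzero]]_(i <- s) [set w [*] g i]) (w [*] z).
Proof.
elim: s z => [|i s IHs] z; first by rewrite !big_nil => ->; rewrite /= hmulr0.
rewrite !big_cons => /haddsP[_ [y [-> hy iyz]]]; apply/haddsP.
exists (w [*] g i), (w [*] y); split => //; first exact: IHs.
exact: hmulD_l.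
Qed.

End ValuedSums.

(** * The length of the truncated ring *)

Section Length.
Variables (K : realType) (H : discValuedHyperfieldType K).

(** By [tr_ideal] every ideal of [trR H] has this form for some [j]. *)
Definition unif_ideal (j : nat) : set (trR H) :=
  range (fun a : trR H => a * trcls 0 (hexp (unif H) j)).

Lemma unif_ideal_submod j : is_submod (unif_ideal j : set (trR H)^o).
Proof.
split; first by exists 0; rewrite ?mul0r.
move=> a _ _ [x _ <-] [y _ <-]; exists (a * x + y) => //.
by rewrite mulrDl -mulrA.
Qed.

Lemma hmpow_unifX j : hmpow 0 (hexp (unif H) j).
Proof. by apply/hmpowP; rewrite hnorm_unifX thetaX_le. Qed.

Lemma unif_ideal_le i j : (i <= j)%N -> unif_ideal j `<=` unif_ideal i.
Proof.
move=> ij _ [a _ <-]; exists (a * trcls 0 (hexp (unif H) (j - i))) => //.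
by rewrite -mulrA trclsM -?hexpD ?subnK //; exact: hmpow_unifX.
Qed.

Variable m : nat.
Hypothesis rho_m : rho H = theta H ^+ m.

(** The [m]-th power of the uniformizer has absolute value [rho H], so its class vanishes and
    [unif_ideal m] is the zero ideal. *)
Lemma unif_ideal_rho j : unif_ideal m `<=` unif_ideal j.
Proof.
have -> : unif_ideal m = [set 0].
  have e : trcls 0 (hexp (unif H) m) = 0 :> trR H.
    apply/(trcls_eq0 (hmpow_unifX m)).
    by rewrite hnorm_unifX rho_m expr0 mulr1.
  rewrite /unif_ideal; apply/seteqP; split=> [_ [a _ <-]|_ ->].
    by rewrite e mulr0.
  by exists 0; rewrite ?mul0r.
by move=> _ ->; have [] := unif_ideal_submod j.
Qed.

(** Equivalent elements are at distance at most [theta H ^+ m], hence at most [theta H ^+ j]. If one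
    of them also has absolute value at most [theta H ^+ j], so has the other, which fails for the
    [i]-th power of the uniformizer. *)
Lemma unif_ideal_lt i j : (i < j)%N -> (j <= m)%N ->
  ~ (unif_ideal j (trcls 0 (hexp (unif H) i))).
Proof.
move=> ij jm [a _]; have [x hx ->] := tr_ex a.
rewrite trclsM //; last exact: hmpow_unifX.
have hxj : hmpow 0 (x [*] hexp (unif H) j) := hmpowM hx (hmpow_unifX j).
move/(trclsP hxj (hmpow_unifX i)); rewrite expr0 mulr1 hdistC => h.
have : hdist (hexp (unif H) i) hzero <= theta H ^+ j.
  apply: (hdist_ultra (y := x [*] hexp (unif H) j)).
    by apply: le_trans h _; rewrite rho_m thetaX_le.
  rewrite hdistC hdist0x hnormM hnorm_unifX ler_piMl ?(ltW (thetaX_gt0 _ _)) //.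
  by have /hmpowP := hx; rewrite expr0.
by rewrite hdistC hdist0x hnorm_unifX thetaX_leE leqNgt ij.
Qed.

Lemma unif_ideal_chain : submod_chain (trR H)^o m.
Proof.
(* Larger exponents give smaller ideals, so the exponent runs down from [m] to make the chain
   increase. *)
exists (fun i => unif_ideal (m - i)); split.
- by move=> i; exact: unif_ideal_submod.
- by move=> i _; apply: unif_ideal_le; rewrite leq_sub2l.
move=> i im e.
apply: (@unif_ideal_lt (m - i.+1)%N (m - i)%N) => /=.
- by rewrite ltn_sub2l.
- exact: leq_subr.
by rewrite e; exists 1; rewrite ?mul1r.
Qed.

(** Each strict inclusion lowers the exponent of the generator by at least one, and the first
    exponent can be taken at most [m]. *)
Lemma submod_chain_le k : submod_chain (trR H)^o k -> (k <= m)%N.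
Proof.
move=> [N [sN iN nN]].
have h i : (i <= k)%N -> exists2 j, (j + i <= m)%N & N i = unif_ideal j.
  elim: i => [|i IHi] ik.
    have [j _ Nj] := tr_ideal (sN 0%N).
    (* An exponent beyond [m] gives the zero ideal, which is [unif_ideal m]. *)
    have [jm|/ltnW mj] := leqP j m; first by exists j; rewrite ?addn0.
    exists m; rewrite ?addn0 // Nj.
    by apply/seteqP; split; [exact: unif_ideal_le|exact: unif_ideal_rho].
  have [j ji Ni] := IHi (ltnW ik); have [j' _ Nj'] := tr_ideal (sN i.+1).
  have jj' : (j' < j)%N.
    rewrite ltnNge; apply/negP => jj'; apply: (nN i ik).
    apply/seteqP; split; first exact: iN.
    by rewrite Ni Nj'; exact: unif_ideal_le.
  by exists j' => //; rewrite addnS; apply: leq_trans ji; rewrite ltn_add2r.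
have [j jk _] := h k (leqnn k).
exact: leq_trans (leq_addl _ _) jk.
Qed.

Lemma mod_length_trR : mod_length (trR H)^o = m.
Proof.
rewrite /mod_length; apply: xget_unique.
  exact: conj unif_ideal_chain submod_chain_le.
move=> n [cn maxn]; apply/eqP; rewrite eqn_leq submod_chain_le //=.
exact: maxn unif_ideal_chain.
Qed.

End Length.

(** * Flatness *)

Section Flat.
Variables (K : realType) (H H' : discValuedHyperfieldType K).
Variable f : vhMorphism H H'.

Lemma tm_flatP : tm_flat (Tr_mor f) <-> vh_flat f.
Proof.
have [m _ [em _]] := rho_ex H; have [m' _ [em' _]] := rho_ex H'.
rewrite /tm_flat /vh_flat /= (mod_length_trR em) (mod_length_trR em') em em'.
rewrite (theta_ram f) -exprM; split=> [-> //|/eqP].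
rewrite eq_le !thetaX_leE => h.
by apply/eqP; rewrite eqn_leq.
Qed.

End Flat.

(** * Sums and equality modulo the truncation *)

Section TrSums.
Variables (K : realType) (H : discValuedHyperfieldType K).

(** All elements of a hyperfield sum share one class, so the multivalued sum becomes an ordinary one
    in the quotient. *)
Lemma trcls_hsum (I : eqType) (s : seq I) (g : I -> H) z :
  (forall i, i \in s -> hmpow 0 (g i)) ->
  (\big[@hadds H/[set hzero]]_(i <- s) [set g i]) z ->
  hmpow 0 z /\ trcls 0 z = \sum_(i <- s) (trcls 0 (g i) : trR H).
Proof.
elim: s z => [|i s IHs] z hg.
  by rewrite !big_nil => ->; split; [exact: hmpow0|].
rewrite !big_cons => /haddsP[_ [y [-> hy iyz]]].
have hi : hmpow 0 (g i) by apply: hg; rewrite mem_head.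
have [|y0 <-] := IHs y _ hy; first by move=> j js; apply: hg; rewrite inE js orbT.
by split; [exact: hmpowD iyz|rewrite (trclsD hi y0 iyz)].
Qed.

(* x - y is a ball of radius rho |x|, so it contains 0 as soon as it contains
   an element of absolute value at most rho |x|. *)
Lemma hdist_rho_eq (x y : H) : hnorm y <= hnorm x ->
  hdist x y <= rho H * hnorm x -> x = y.
Proof.
move=> yx dxy; have [//|/eqP xy] := eqVneq x y.
have [w xyw] := hadd_ex x ([-] y); rewrite (hdistE xy xyw) in dxy.
have [c e] := rho_sum x ([-] y); rewrite Defs.hnormN max_l // in e.
apply/hsub0P; rewrite e /hcball /= -/(hdist _ _).
apply: (@hdist_ultra _ _ _ w); last by rewrite hdistC hdist0x.
by have := xyw; rewrite e.
Qed.

(** When [x] has absolute value 1, the radius [rho H] of the equivalence is exactly the bound under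
    which [hdist_rho_eq] forces equality. *)
Lemma trcls_inj1 (x y : H) : hnorm x = 1 -> hmpow 0 y ->
  trcls 0 x = trcls 0 y -> x = y.
Proof.
move=> x1 hy; have hx : hmpow 0 x by apply/hmpowP; rewrite x1 expr0.
move/(trclsP hx hy) => h; apply: hdist_rho_eq.
  by have /hmpowP := hy; rewrite expr0 x1.
by rewrite x1 -[1](expr0 (theta H)).
Qed.

Lemma hint_hmpow0 (x : H) : hint x <-> hmpow 0 x.
Proof.
by split=> [/hintP h|/hmpowP h]; [apply/hmpowP|apply/hintP]; rewrite expr0 in h *.
Qed.

End TrSums.

(** Passes from generators indexed by position, as in [fin_gen], to a duplicate-free list with
    coefficients indexed by the generators, as in [vh_finite]; coefficients of equal entries are
    added. *)
Lemma sum_undup (R : pzRingType) (V : lmodType R) (s : seq V) (c : nat -> R) :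
  exists d : V -> R, \sum_(i < size s) c i *: s`_i = \sum_(t <- undup s) d t *: t.
Proof.
exists (fun t => \sum_(i < size s | s`_i == t) c i).
under [RHS]eq_bigr => t _ do rewrite scaler_suml.
rewrite (exchange_big_dep xpredT) //=; apply: eq_bigr => i _.
by rewrite -big_filter (eq_filter (a2 := pred1 s`_i)) ?filter_pred1_uniq ?big_seq1
  ?undup_uniq ?mem_undup ?mem_nth // => t; rewrite /= eq_sym.
Qed.

(** * Finiteness *)

Section Finite.
Variables (K : realType) (H H' : discValuedHyperfieldType K).
Variable f : vhMorphism H H'.

Lemma vh_finite_tm_finite : vh_finite f -> tm_finite (Tr_mor f).
Proof.
move=> [S [_ hS gen]]; exists (map (trcls 0) S) => b.
have [x hx ->] := tr_ex b; have [a [ha xa]] := gen x (iffRL (hint_hmpow0 x) hx).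
exists (fun i => trcls 0 (a (nth hzero S i))).
have hfa s : s \in S -> hmpow 0 (f (a s)).
  by move=> sS; apply: hmpow_map0; apply/hint_hmpow0/ha.
have hs s : s \in S -> hmpow 0 s by move=> /hS/hint_hmpow0.
have hfas s : s \in S -> hmpow 0 (f (a s) [*] s).
  by move=> sS; exact: (hmpowM (hfa _ sS) (hs _ sS)).
have [_ ->] := trcls_hsum hfas xa.
rewrite size_map (big_nth hzero) big_mkord; apply: eq_bigr => i _.
have iS : nth hzero S i \in S by rewrite mem_nth.
rewrite (nth_map hzero) // /GRing.scale /= /restr_scale /= tr_phiE.
  by rewrite -(trclsM (hfa _ iS) (hs _ iS)).
by apply/hint_hmpow0/ha.
Qed.

Lemma ram_deg_gt0 : (0 < ram_deg H H')%N.
Proof.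
rewrite lt0n; apply/eqP => r0.
by have := theta_lt1 H; rewrite (theta_ram f) r0 expr0 ltxx.
Qed.

Lemma tm_finite_unit : tm_finite (Tr_mor f) ->
  exists s : seq (trR H'), uniq s /\ forall u : H', hnorm u = 1 ->
    exists d : trR H' -> trR H, (\big[@hadds H'/[set hzero]]_(t <- s)
      [set f (trlift (d t)) [*] trlift t]) u.
Proof.
move=> [s gen]; exists (undup s); split=> [|u u1]; first exact: undup_uniq.
have [c ec] := gen (trcls 0 u); have [d ed] := sum_undup s c.
exists d; set g := fun t => f (trlift (d t)) [*] trlift t.
have hg t : hmpow 0 (g t).
  exact: (hmpowM (hmpow_map0 f (trlift_mem (d t))) (trlift_mem t)).
(* Any element [z] of the sum will do: it has the class of [u], hence equals [u]. *)
have [z hz] := hsum_ex (undup s) g.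
have [z0 ez] := trcls_hsum (fun t _ => hg t) hz.
suff -> : u = z by [].
apply: trcls_inj1 => //; rewrite ec ed ez; apply: eq_bigr => t _.
rewrite /GRing.scale /= /restr_scale /=.
rewrite -(trclsM (hmpow_map0 f (trlift_mem (d t))) (trlift_mem t)).
by rewrite trliftK.
Qed.

Lemma tm_finite_vh_finite : tm_finite (Tr_mor f) -> vh_finite f.
Proof.
move=> /tm_finite_unit[s [us gen]].
pose p' k := hexp (unif H') k.
have p'0 k : p' k <> hzero by apply: hexp_neq0; exact: unif_neq0.
pose T k := [seq p' k [*] trlift t | t <- s].
(* The lists [T k] may overlap for different [k], hence [undup]. *)
pose S := undup (flatten [seq T k | k <- iota 0 (ram_deg H H')]).
have uT k : uniq (T k).
  rewrite map_inj_uniq // => t t' /(hmulI (p'0 k)) e.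
  by rewrite -[t]trliftK e trliftK.
have ST k : (k < ram_deg H H')%N -> {subset T k <= S}.
  move=> kr y yT; rewrite mem_undup; apply/flattenP; exists (T k) => //.
  by apply: map_f; rewrite mem_iota.
exists S; split; first exact: undup_uniq.
  move=> y; rewrite mem_undup => /flattenP[_ /mapP[k _ ->] /mapP[t _ ->]].
  by apply/hint_hmpow0; exact: (hmpowM (hmpow_unifX H' k) (trlift_mem t)).
move=> x /hintP x1; have [->|/eqP x0] := eqVneq x hzero.
  exists (fun=> hzero); split; first by move=> y _; apply/hint_hmpow0/hmpow0.
  by rewrite big1 // => y _; rewrite vhmap0 hmul0.
have [n xn] := hnormP x0 x1.
(* Euclidean division gives [w] the absolute value of [x], so that [gen] applies to the quotient of
   [x] by [w]. *)
pose q := (n %/ ram_deg H H')%N; pose k := (n %% ram_deg H H')%N.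
have kr : (k < ram_deg H H')%N by rewrite ltn_mod ram_deg_gt0.
pose w := f (hexp (unif H) q) [*] p' k.
have wn : hnorm w = theta H' ^+ n.
  rewrite hnormM vhmap_norm !hnorm_unifX (theta_ram f) -exprM -exprD.
  by rewrite mulnC -divn_eq.
have w0 : w <> hzero by apply: hnorm_gt0N; rewrite wn thetaX_gt0.
have xw : x = w [*] (hinv w [*] x) by rewrite hmulA hmulV // hmul1.
have [|d /(hsumM w)] := gen (hinv w [*] x).
  by rewrite hnormM hnormV // wn xn mulVf // gt_eqF // thetaX_gt0.
rewrite -xw => hx.
(* Only the generators in [T k] are used. Dividing such a [y] by [p' k] and taking the class
   recovers the [t] it came from. *)
pose a y := if y \in T k
  then hexp (unif H) q [*] trlift (d (trcls 0 (hinv (p' k) [*] y))) else hzero.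
exists a; split=> [y _|].
  apply/hint_hmpow0; rewrite /a; case: ifP => _; last exact: hmpow0.
  exact: (hmpowM (hmpow_unifX H q) (trlift_mem _)).
(* Terms outside [T k] are zero; the remaining sum is reordered along [T k] and reindexed by [s]. *)
rewrite (bigID (mem (T k))) /= [X in hadds _ X]big1 => [|y /negbTE yT]; last first.
  by rewrite /a yT vhmap0 hmul0.
rewrite Monoid.mulm1 -big_filter (perm_big (T k)); last first.
  apply: uniq_perm; rewrite ?filter_uniq ?undup_uniq // => y.
  by rewrite mem_filter; apply: andb_idr; exact: ST.
rewrite big_map; move: hx.
rewrite (eq_big_seq (fun t =>
  [set f (a (p' k [*] trlift t)) [*] (p' k [*] trlift t)])) // => t ts.
have tT : p' k [*] trlift t \in T k by exact: map_f.
congr [set _]; rewrite /a tT.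
rewrite [hinv _ [*] _]hmulA [hinv _ [*] _]hmulC hmulV // hmul1 trliftK.
rewrite vhmapM /w -!hmulA; congr (_ [*] _).
by rewrite !hmulA [p' k [*] f _]hmulC.
Qed.

End Finite.

Theorem theorem8p4 (K : realType) (H H' : discValuedHyperfieldType K)
    (hH : ~ is_field H) (hH' : ~ is_field H') (f : vhMorphism H H') :
  (vh_finite f /\ vh_flat f) <-> (tm_finite (Tr_mor f) /\ tm_flat (Tr_mor f)).
Proof.
split=> -[fin flat]; split; try exact/tm_flatP.
  exact: vh_finite_tm_finite.
exact: tm_finite_vh_finite.
Qed.
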